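(* Let $X\subset\mathbb{R}^d$ be compact and let $f\in\mathrm{PAff}(X;X)$ be a non-degenerate piecewise affine map. Then $$h_{\mathrm{top}}(f)\le\lambda^+(f)+\frac{d(d-1)}{2}\bigl(\lambda_{\max}(f)-\lambda_{\min}(f)\bigr).$$
   Context: **Piecewise affine maps.** A piecewise affine map $(X,\mathcal Z,f)$, written $f\in\mathrm{PAff}(X;X)$, consists of a compact set $X\subset\mathbb{R}^d$, a finite collection $\mathcal Z$ of open, pairwise disjoint polytopes such that $X'=\bigcup_{Z\in\mathcal Z}Z$ is dense in $X$, and a map $f:X'\to X$ such that $f_Z:=f|_Z:Z\to X$ is affine for each $Z\in\mathcal Z$. The $f_Z$ are the affine components of $f$; the linear part of $f_Z$ is $f_Z'$, and $d_xf:=f_Z'$ for $x\in Z$. $f$ is non-degenerate if every $f_Z'$ is invertible. Put $U_n=\bigcap_{k=0}^{n-1}f^{-k}(X')$, the set of points where $f^n$ is defined; for $x\in U_n$, $d_xf^n$ is the corresponding product of linear parts along the orbit. **Topological entropy.** Let $d(\cdot,\cdot)$ be a metric defining the standard topology on $X$, $d_n^f(x,y)=\max_{0\le k<n}d(f^kx,f^ky)$, and let $S(d_n^f,\epsilon)$ be the minimal number of $d_n^f$-balls of radius $\epsilon$ needed to cover $U_n$. Then $h_{\mathrm{top}}(f)=\lim_{\epsilon\to0}\limsup_{n\to\infty}\frac1n\log S(d_n^f,\epsilon)$ (independent of the choice of metric). **Expansion rates.** $\lambda^+(f)=\limsup_{n\to\infty}\sup_{x\in U_n}\frac1n\max_{0\le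 k\le d}\log\|\Lambda^kd_xf^n\|$ (with $\Lambda^k$ the $k$-th exterior power, $\|\Lambda^0\|=1$), $\lambda_{\max}(f)=\limsup_{n\to\infty}\sup_{x\in U_n}\frac1n\log\|d_xf^n\|$ and $\lambda_{\min}(f)=-\limsup_{n\to\infty}\sup_{x\in U_n}\frac1n\log\|(d_xf^n)^{-1}\|$, with norms induced by the Euclidean norm. *)

(* Defs.v *)
From HB Require Import structures.
From mathcomp Require Import all_boot all_order all_algebra.
From mathcomp Require Import all_classical all_reals all_analysis.
Import Order.TTheory GRing.Theory Num.Theory.
Import numFieldNormedType.Exports.
Set Implicit Arguments.
Unset Strict Implicit.
Unset Printing Implicit Defensive.
Local Open Scope classical_set_scope.
Local Open Scope ring_scope.

Section Norms.
Context {R : realType}.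

(* The norm provided by the library on matrices is the sup norm. *)
Definition enorm n (x : 'cV[R]_n) : R := Num.sqrt (\sum_i x i 0 ^+ 2).

Definition opnorm m n (A : 'M[R]_(m, n)) : R :=
  sup [set enorm (A *m x) | x in [set x | enorm x <= 1]].

(* The strictly increasing maps I : 'I_k -> 'I_d index the standard basis
   e_I = e_(I 0) /\ ... /\ e_(I (k - 1)) of the k-th exterior power of R^d. *)
Definition incr_idx d k : {set {ffun 'I_k -> 'I_d}} :=
  finset (fun I : {ffun 'I_k -> 'I_d} =>
    [forall i : 'I_k, forall j : 'I_k, (i < j)%N ==> (I i < I j)%N]).

(* Matrix in the basis (e_I) of the k-th exterior power of A: its (I, J) entry
   is the k x k minor of A with rows I and columns J.  The basis (e_I) is
   orthonormal for the inner product <u_1 /\ ... /\ u_k, v_1 /\ ... /\ v_k> =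
   det (<u_i, v_j>) induced by the Euclidean structure of R^d, so opnorm of
   this matrix is the operator norm of the exterior power. *)
Definition extpow d k (A : 'M[R]_d) : 'M[R]_(#|incr_idx d k|) :=
  \matrix_(I < #|incr_idx d k|, J < #|incr_idx d k|)
    \det (mxsub (enum_val I) (enum_val J) A).

End Norms.

Section Polytopes.
Context {R : realType}.

(* Polytopes are convex: bounded finite intersections of half-spaces. *)
Definition open_halfspace d (H : set 'cV[R]_d) : Prop :=
  exists (a : 'rV[R]_d) (b : R), a != 0 /\ H = [set x | (a *m x) 0 0 < b].

Definition open_polytope d (Z : set 'cV[R]_d) : Prop :=
  [/\ Z !=set0,
      exists (m : nat) (H : 'I_m -> set 'cV[R]_d),
        (forall i, open_halfspace (H i)) /\ Z = \bigcap_i H i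
    & exists M : R, forall x, Z x -> enorm x <= M].

End Polytopes.

(* The map is a total function of which only the values on the union of the
   pieces are constrained; nothing below depends on the other values. *)
Record paff (R : realType) (d : nat) := Paff {
  paff_dom : set 'cV[R]_d;
  npieces : nat;
  piece : 'I_npieces -> set 'cV[R]_d;
  pmap :> 'cV[R]_d -> 'cV[R]_d;
  linpart : 'I_npieces -> 'M[R]_d;
  transl : 'I_npieces -> 'cV[R]_d;
  dom_compact : compact paff_dom;
  piece_polytope : forall i, open_polytope (piece i);
  piece_disjoint : forall i j, i != j -> piece i `&` piece j = set0;
  piece_dom : \bigcup_i piece i `<=` paff_dom;
  piece_dense : paff_dom `<=` closure (\bigcup_i piece i);
  pmap_dom : forall x, (\bigcup_i piece i) x -> paff_dom (pmap x);
  pmap_affine : forall i x, piece i x -> pmap x = linpart i *m x + transl i }.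

Arguments piece {R d} p i.
Arguments linpart {R d} p i.
Arguments transl {R d} p i.

Section PiecewiseAffine.
Context {R : realType} {d : nat}.
Implicit Types (f : paff R d) (rho : 'cV[R]_d -> 'cV[R]_d -> R).

Definition paff_nondegenerate f : Prop := forall i, linpart f i \in unitmx.

Definition regular_set f : set 'cV[R]_d := \bigcup_i piece f i.

Definition iter_dom f (n : nat) : set 'cV[R]_d :=
  [set x | forall k, (k < n)%N -> regular_set f (iter k f x)].

(* At most one piece contains x; the default value is only used off
   regular_set f. *)
Definition diff_at f (x : 'cV[R]_d) : 'M[R]_d :=
  if [pick i | x \in piece f i] is Some i then linpart f i else 0.

Fixpoint diff_iter f (n : nat) (x : 'cV[R]_d) : 'M[R]_d :=
  if n is m.+1 then diff_at f (iter m f x) *m diff_iter f m x else 1%:M.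

(* rho restricts to a metric on X whose balls generate the neighbourhoods of
   the subspace topology of X. *)
Definition metrizes (X : set 'cV[R]_d) rho : Prop :=
  [/\ forall x y, X x -> X y -> 0 <= rho x y,
      forall x y, X x -> X y -> (rho x y = 0 <-> x = y),
      forall x y, X x -> X y -> rho x y = rho y x,
      forall x y z, X x -> X y -> X z -> rho x z <= rho x y + rho y z
    & forall x, X x -> forall A : set 'cV[R]_d,
        within X (nbhs x) A <->
        exists2 e : R, 0 < e & forall y, X y -> rho x y < e -> A y].

Definition bowen_dist rho f (n : nat) (x y : 'cV[R]_d) : R :=
  \big[Num.max/0]_(k < n) rho (iter k f x) (iter k f y).

(* Each finite sequence s of centres in iter_dom f n stands for the balls
   { y in iter_dom f n | bowen_dist rho f n x y < e } with x in s. *)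
Definition cover_num rho f (n : nat) (e : R) : \bar R :=
  ereal_inf [set ((size s)%:R)%:E | s in [set s : seq 'cV[R]_d |
    (forall x, x \in s -> iter_dom f n x) /\
    (forall y, iter_dom f n y ->
       exists2 x, x \in s & bowen_dist rho f n x y < e)]].

(* lne 0 = -oo, whereas ln 0 = 0. *)
Definition htop rho f : \bar R :=
  lim (limn_esup (fun n => (n%:R^-1)%:E * lne (cover_num rho f n e))%E
    @[e --> 0^'+]).

Definition lambda_plus f : \bar R :=
  limn_esup (fun n => ereal_sup [set
    ((n%:R^-1)%:E *
       \big[maxe/-oo]_(k < d.+1) lne (opnorm (extpow k (diff_iter f n x)))%:E)%E
    | x in iter_dom f n]).

Definition lambda_max f : \bar R :=
  limn_esup (fun n => ereal_sup [set
    ((n%:R^-1)%:E * lne (opnorm (diff_iter f n x))%:E)%E | x in iter_dom f n]).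

Definition lambda_min f : \bar R :=
  (- limn_esup (fun n => ereal_sup [set
    ((n%:R^-1)%:E * lne (opnorm (invmx (diff_iter f n x)))%:E)%E
    | x in iter_dom f n]))%E.

End PiecewiseAffine.

(* Main.v *)
Require Import Defs.
From mathcomp Require Import all_boot all_order all_algebra.
From mathcomp Require Import all_classical all_reals all_analysis.
From mathcomp Require Import perm ring lra.
Import Order.TTheory GRing.Theory Num.Theory.
Import numFieldNormedType.Exports.
Set Implicit Arguments.
Unset Strict Implicit.
Unset Printing Implicit Defensive.
Local Open Scope classical_set_scope.
Local Open Scope ring_scope.

(* A point is coded by the pieces that its orbit visits together with cells of
   small diameter, and the number of codes is estimated block by block, one
   block being n iterations of f.

   Over one block, an affine image of a cell of diameter eta is covered by
   C max |minors| <= C exp(n lambda^+) cells of diameter eta, and a small cell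
   meets at most M_d(n) cylinders of length n, where M_m(n) bounds the number of
   n-cylinders adherent to a point x whose tangent cones at x are invariant
   under a given subspace V of codimension m.  Hence
   h_top <= lambda^+ + growth rate of M_d.

   M_0 = 1 by disjointness of the pieces.  For M_{m+1}, the directions in
   R^d / V form a sphere of dimension m on which a block acts with distortion at
   most C |A| |A^-1|, and cylinders with close directions at x share a tangent
   direction u0; they are adherent to x + t u0 and invariant under V + R u0.
   So the rate of M_{m+1} is at most that of M_m plus
   m (lambda_max - lambda_min), and 0 + 1 + ... + (d-1) = d(d-1)/2. *)

(** * Counting and cells of small diameter *)

(** The order in which constants are chosen shapes the argument. Factors that depend only on the
    dimension are paid in every block and become negligible by taking n large. The mesh eta comes
    from compactness applied to the finitely many n-cylinders, so it depends on n in an uncontrolled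
    way; but images are cut back to the same mesh after every block, so the first subdivision is
    paid once and disappears when the number of blocks grows. A point adherent to several cylinders
    has no orbit of its own. Each word therefore acts by the affine extension of its branches, and
    cylinders are handled as systems of strict linear inequalities whose active constraints describe
    the tangent cone. The subspace V is the kernel of a matrix P, and invariance under V says that
    active normals lie in the row space of P. Keeping P normalized (entries at most 1, an identity
    block in the columns J) has two effects: the distortion of a block is controlled by |A| |A^-1|
    alone, and the coordinates of the active normals stay in a finite list, which makes eta uniform
    in x and V. *)

Lemma size_fibers (R : realType) (U V : eqType) (f : U -> V) (s : seq U)
    (A B : R) : 0 <= B ->
  (size (undup (map f s)))%:R <= A ->
  (forall v, (size [seq x <- s | f x == v])%:R <= B) ->
  (size s)%:R <= A * B.
Proof.
move=> B0 sA sB.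
suff -> : size s = (\sum_(v <- undup (map f s)) size [seq x <- s | f x == v])%N.
  rewrite natr_sum; apply: le_trans (_ : (size (undup (map f s)))%:R * B <= _).
    by rewrite -sum1_size natr_sum mulr_suml; apply: ler_sum => v _; rewrite mul1r.
  exact: ler_wpM2r.
have: all [in undup (map f s)] (map f s).
  by apply/allP => v; rewrite mem_undup.
elim: s (undup (map f s)) (undup_uniq (map f s)) {sA sB} => [|x s IHs] t ut /=.
  by rewrite big1.
case/andP=> xt /(IHs t ut) ->.
rewrite [RHS](bigD1_seq (f x)) //= eqxx /= [in LHS](bigD1_seq (f x)) //=.
by congr (_.+1); congr addn; apply: eq_bigr => v /negbTE; rewrite eq_sym => ->.
Qed.

Lemma size_fibers_fin (R : realType) (U : eqType) (T : finType) (f : U -> T)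
    (s : seq U) (B : R) : 0 <= B ->
  (forall t, (size [seq x <- s | f x == t])%:R <= B) ->
  (size s)%:R <= #|T|%:R * B.
Proof.
move=> B0; apply: size_fibers => //; rewrite ler_nat.
by rewrite -(card_uniqP (undup_uniq _)) max_card.
Qed.

Section MatrixNorm.
Context {R : realType}.

Lemma mx_norm_le m n (A : 'M[R]_(m, n)) (D : R) : 0 <= D ->
  (forall i j, `|A i j| <= D) -> `|A| <= D.
Proof.
move=> D0 AD; rewrite /Num.Def.normr/= mx_normrE (bigmax_le _ D0)//=.
Qed.

Lemma mx_norm_entry m n (A : 'M[R]_(m, n)) i j : `|A i j| <= `|A|.
Proof.
by rewrite [leRHS]/Num.Def.normr/= mx_normrE; apply/bigmax_geP; right; exists (i, j).
Qed.

Lemma mxBE m n (A B : 'M[R]_(m, n)) i j : (A - B) i j = A i j - B i j.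
Proof. by rewrite !mxE. Qed.

Lemma mx_norm_mul m n p (A : 'M[R]_(m, n)) (B : 'M[R]_(n, p)) :
  `|A *m B| <= n%:R * `|A| * `|B|.
Proof.
apply: mx_norm_le => [|i j]; first by rewrite !mulr_ge0.
rewrite mxE; apply: le_trans (ler_norm_sum _ _ _) _.
apply: le_trans (_ : \sum_(k < n) `|A| * `|B| <= _); last first.
  by rewrite sumr_const card_ord -[leLHS]mulr_natl mulrA.
by apply: ler_sum => k _; rewrite normrM ler_pM // mx_norm_entry.
Qed.

Lemma mx_norm_mul_le m n p (A : 'M[R]_(m, n)) (B : 'M[R]_(n, p)) a b :
  `|A| <= a -> `|B| <= b -> `|A *m B| <= n%:R * a * b.
Proof.
move=> Aa Bb; apply: le_trans (mx_norm_mul A B) _.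
by rewrite -!mulrA ler_wpM2l // ler_pM.
Qed.

End MatrixNorm.

Section Codes.
Context {R : realType}.

(* A code of a finite type T splits a bounded set into #|T| cells. *)
Lemma scalar_code (D eta : R) : 0 <= D -> 0 < eta ->
  exists c : R -> 'I_(Num.trunc (2 * D / eta)).+1, forall x y,
    `|x| <= D -> `|y| <= D -> c x = c y -> `|x - y| <= eta.
Proof.
move=> D0 eta0; exists (fun x => inord (Num.trunc ((x + D) / eta))).
have P0 x : `|x| <= D -> 0 <= (x + D) / eta.
  by rewrite ler_norml => /andP[? ?]; apply: divr_ge0; [lra|exact: ltW].
have lt x : `|x| <= D ->
    (Num.trunc ((x + D) / eta) < (Num.trunc (2 * D / eta)).+1)%N.
  move=> xD; rewrite ltnS; apply: le_truncn.
  by rewrite ler_pM2r ?invr_gt0 //; move: xD; rewrite ler_norml => /andP[? ?]; lra.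
move=> x y xD yD /(congr1 val); rewrite /= !inordK ?lt // => exy.
have := truncn_itv (P0 x xD); have := truncn_itv (P0 y yD).
rewrite exy; set k := Num.trunc _ => /andP[y1 y2] /andP[x1 x2].
rewrite -natr1 in x2, y2.
move: x1 x2 y1 y2; rewrite !ler_pdivlMr // !ltr_pdivrMr // => x1 x2 y1 y2.
rewrite ler_norml; apply/andP; split; nra.
Qed.

Lemma vector_code q (D eta : R) : 0 <= D -> 0 < eta ->
  exists c : 'cV[R]_q -> {ffun 'I_q -> 'I_(Num.trunc (2 * D / eta)).+1},
    forall x y : 'cV[R]_q, `|x| <= D -> `|y| <= D -> c x = c y ->
      `|x - y| <= eta.
Proof.
move=> D0 eta0; have [c cP] := scalar_code D0 eta0.
exists (fun x => [ffun i => c (x i 0)]) => x y xD yD /ffunP exy.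
apply: mx_norm_le => [|i j]; first exact: ltW.
rewrite ord1 !mxE; apply: cP; first exact: le_trans (mx_norm_entry _ _ _) xD.
  exact: le_trans (mx_norm_entry _ _ _) yD.
by have := exy i; rewrite !ffunE.
Qed.

Lemma trunc_code_le (D eta : R) : 0 <= D -> 0 < eta ->
  (Num.trunc (2 * D / eta)).+1%:R <= 2 * D / eta + 1.
Proof.
move=> D0 eta0; rewrite -natr1 lerD2r truncn_le //.
by rewrite divr_ge0 // ?mulr_ge0 // ltW.
Qed.

Lemma vector_code_at q (D eta : R) (z0 : 'cV[R]_q) : 0 <= D -> 0 < eta ->
  exists2 T : finType, #|T|%:R <= (2 * D / eta + 1) ^+ q &
  exists c : 'cV[R]_q -> T,
    forall x y : 'cV[R]_q, `|x - z0| <= D -> `|y - z0| <= D -> c x = c y ->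
      `|x - y| <= eta.
Proof.
move=> D0 eta0; have [c cP] := vector_code q D0 eta0.
exists {ffun 'I_q -> 'I_(Num.trunc (2 * D / eta)).+1}.
  rewrite card_ffun !card_ord natrX lerXn2r ?trunc_code_le ?nnegrE //.
  exact: le_trans (trunc_code_le D0 eta0).
exists (fun x => c (x - z0)) => x y xD yD /(cP _ _ xD yD).
by rewrite opprB addrA subrK.
Qed.

Lemma norm_row' q (j : 'I_q.+1) (x : 'cV[R]_q.+1) : `|row' j x| <= `|x|.
Proof. by apply: mx_norm_le => // i k; rewrite mxE mx_norm_entry. Qed.

(* The unit sphere of the sup norm has dimension q: the remaining coordinate
   is 1 or -1. *)
Lemma sphere_code q (D eta : R) (z0 : 'cV[R]_q.+1) : 0 <= D -> 0 < eta ->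
  exists2 T : finType, #|T|%:R <= (q.+1 * 2)%:R * (2 * D / eta + 1) ^+ q &
  exists c : 'cV[R]_q.+1 -> T, forall x y : 'cV[R]_q.+1, `|x| = 1 -> `|y| = 1 ->
    `|x - z0| <= D -> `|y - z0| <= D -> c x = c y -> `|x - y| <= eta.
Proof.
move=> D0 eta0.
have [c cP] := vector_code q D0 eta0.
exists ('I_q.+1 * bool *
        {ffun 'I_q -> 'I_(Num.trunc (2 * D / eta)).+1})%type.
  rewrite !card_prod card_ffun !card_ord card_bool natrM natrX ler_wpM2l //.
  rewrite lerXn2r ?trunc_code_le ?nnegrE //.
  exact: le_trans (trunc_code_le D0 eta0).
(* A coordinate that attains the norm; on the unit sphere the default [ord0] is never reached. *)
pose j (x : 'cV[R]_q.+1) := odflt ord0 [pick j | `|x j 0| == 1].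
have jP (x : 'cV[R]_q.+1) : `|x| = 1 -> `|x (j x) 0| = 1.
  move=> x1; rewrite /j; case: pickP => [i /eqP //|] no.
  have [|[i k]] := @mx_norm_neq0 _ _ _ x.
    by move: x1; rewrite /Num.Def.normr /= => ->; rewrite oner_neq0.
  move: x1; rewrite {1}/Num.Def.normr /= => -> /= /esym/eqP.
  by rewrite ord1 no.
exists (fun x => (j x, 0 <= x (j x) 0, c (row' (j x) (x - z0)))).
move=> x y x1 y1 xD yD [exy sxy].
rewrite -exy => /cP; move: (jP x x1) (jP y y1); rewrite -exy in sxy *.
move=> xj yj cxy.
apply: mx_norm_le => [|i k]; first exact: ltW.
rewrite ord1 !mxE; have [i' ->|->] := unliftP (j x) i.
  have := mx_norm_entry (row' (j x) (x - z0) - row' (j x) (y - z0)) i' 0.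
  rewrite !mxE opprB addrA subrK => /le_trans; apply; apply: cxy.
    exact: le_trans (norm_row' _ _) xD.
  exact: le_trans (norm_row' _ _) yD.
suff -> : x (j x) 0 = y (j x) 0 by rewrite subrr normr0 ltW.
move: xj yj sxy.
have [x0|x0] := leP 0 (x (j x) 0); have [y0|y0] := leP 0 (y (j x) 0) => //.
  by rewrite !ger0_norm // => -> ->.
rewrite !ltr0_norm // => xj yj _; lra.
Qed.

End Codes.

(** * Covering the image of a ball by an affine map *)

Section Minors.
Context {R : realType}.

Definition schur p q (A : 'M[R]_(p, q.+1)) i0 j0 : 'M[R]_(p, q) :=
  \matrix_(i, j) (A i (lift j0 j) - A i j0 * A i0 (lift j0 j) / A i0 j0).

(** Eliminating the pivot column factors the bordered submatrix as a unipotent lower triangular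
    matrix times a block upper triangular one. Hence minors of the Schur complement are minors of A
    divided by the pivot. *)
Lemma det_schur p q (A : 'M[R]_(p, q.+1)) i0 j0 k (I : 'I_k -> 'I_p)
    (J : 'I_k -> 'I_q) : A i0 j0 != 0 ->
  A i0 j0 * \det (mxsub I J (schur A i0 j0)) =
  \det (mxsub (fun i : 'I_(1 + k) => if fintype.split i is inr i' then I i' else i0)
          (fun j : 'I_(1 + k) => if fintype.split j is inr j' then lift j0 (J j') else j0) A).
Proof.
move=> a0; set B := mxsub _ _ A.
have -> : B = block_mx 1%:M 0 (\col_i (A (I i) j0 / A i0 j0)) 1%:M *m
   block_mx (A i0 j0)%:M (\row_j A i0 (lift j0 (J j))) 0 (mxsub I J (schur A i0 j0)).
  rewrite mulmx_block !mul1mx !mul0mx ?mulmx0 !addr0.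
  apply/matrixP => i j; rewrite [LHS]mxE.
  case: (split_ordP i) => i' ->; case: (split_ordP j) => j' ->.
  - by rewrite block_mxEul !ord1 !mxE eqxx.
  - by rewrite block_mxEur !mxE.
  - rewrite block_mxEdl ord1 !mxE big_ord1 !mxE eqxx mulr1n.
    by rewrite divfK.
  - rewrite block_mxEdr !mxE big_ord1 !mxE.
    by rewrite addrCA mulrAC subrr addr0.
by rewrite det_mulmx det_lblock det_ublock !det1 !mul1r det_scalar1.
Qed.

(** All index maps are allowed because the maps bordered by a pivot in [det_schur] need not be
    increasing. The empty minor, k = 0, gives 1 <= M. *)
Definition minors_le p q (A : 'M[R]_(p, q)) (M : R) :=
  forall k (I : 'I_k -> 'I_p) (J : 'I_k -> 'I_q), `|\det (mxsub I J A)| <= M.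

Lemma minors_le_ge1 p q (A : 'M[R]_(p, q)) (M : R) : minors_le A M -> 1 <= M.
Proof.
have void T : 'I_0 -> T by case.
by move=> /(_ 0%N (void _) (void _)); rewrite det_mx00 normr1.
Qed.

(* Gaussian elimination with complete pivoting: every pivot of modulus at least
   1 costs a number of cells proportional to its modulus, and the product of
   these pivots is a minor. *)
Lemma linear_code p q : exists2 C : R, 1 <= C &
  forall (A : 'M[R]_(p, q)) (M eta : R), minors_le A M -> 0 < eta ->
  exists2 T : finType, #|T|%:R <= C * M &
  exists c : 'cV[R]_q -> T, forall x y : 'cV[R]_q, `|x| <= eta -> `|y| <= eta ->
    c x = c y -> `|A *m x - A *m y| <= 2 * q%:R * eta.
Proof.
elim: q => [|q [C C1 IH]].
  exists 1 => // A M eta AM eta0; exists unit.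
    by rewrite card_unit mul1r (minors_le_ge1 AM).
  exists (fun=> tt) => x y _ _ _; apply: mx_norm_le => [|i j].
    by rewrite mulr0 mul0r.
  by rewrite !mxE !big_ord0 subr0 normr0 mulr0 mul0r.
exists ((2 * q.+1%:R + 1) * C) => [|A M eta AM eta0].
  by rewrite -[1]mulr1 ler_pM //; have := ler0n R q.+1; lra.
have M1 := minors_le_ge1 AM.
have [/forallP small|] := boolP [forall i, forall j, `|A i j| <= 1].
  exists unit.
    rewrite card_unit -[1%:R](mulr1 1) ler_pM //.
    by rewrite -[1]mulr1 ler_pM //; have := ler0n R q.+1; lra.
  exists (fun=> tt) => x y xe ye _; rewrite -mulmxBr.
  have A1 : `|A| <= 1 by apply: mx_norm_le => // i j; exact: (forallP (small i)).
  have xy : `|x - y| <= 2 * eta.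
    by apply: le_trans (ler_normB _ _) _; lra.
  apply: le_trans (mx_norm_mul_le A1 xy) _; by rewrite mulr1 mulrCA mulrA.
rewrite negb_forall => /existsP[i1]; rewrite negb_forall => /existsP[j1].
rewrite -ltNge => big.
have [[i0 j0] /= amax] : exists t : 'I_p * 'I_q.+1, forall i j, `|A i j| <= `|A t.1 t.2|.
  have [t _ tmax] := arg_maxP (fun t : 'I_p * 'I_q.+1 => `|A t.1 t.2|) (erefl : xpredT (i1, j1)).
  by exists t => i j; apply: (tmax (i, j)).
set a := A i0 j0 in amax *.
have a1 : 1 < `|a| by apply: lt_le_trans big (amax _ _).
have agt0 : 0 < `|a| by apply: lt_trans a1.
have a0 : a != 0 by rewrite -normr_gt0.
have SM : minors_le (schur A i0 j0) (M / `|a|).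
  move=> k I J; rewrite ler_pdivlMr // mulrC -normrM det_schur //.
have [T T1 [c cP]] := IH _ _ _ SM eta0.
have D0 : 0 <= q.+1%:R * `|a| * eta by rewrite !mulr_ge0 // ltW.
have [c0 c0P] := scalar_code D0 eta0.
exists ('I_(Num.trunc (2 * (q.+1%:R * `|a| * eta) / eta)).+1 * T)%type.
  rewrite card_prod natrM card_ord.
  (* Coding the pivot coordinate costs a factor proportional to the modulus of a; the minors of the
     Schur complement give back its inverse. *)
  have -> : (2 * q.+1%:R + 1) * C * M = ((2 * q.+1%:R + 1) * `|a|) * (C * (M / `|a|)).
    by field; rewrite gt_eqF.
  rewrite ler_pM //; apply: le_trans (trunc_code_le D0 eta0) _.
  by rewrite mulrA mulfK ?gt_eqF //; nra.
exists (fun x => (c0 ((A *m x) i0 0), c (row' j0 x))) => x y xe ye [e0 e1].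
(* Each coordinate of the image is the pivot coordinate, with a coefficient of modulus at most 1,
   plus a term of the Schur complement. The pivot step thus adds at most eta to the diameter. *)
have dec (z : 'cV[R]_q.+1) i : (A *m z) i 0 =
    A i j0 / a * (A *m z) i0 0 + (schur A i0 j0 *m row' j0 z) i 0.
  rewrite !mxE (bigD1_ord j0) //= [in RHS](bigD1_ord j0) //= -/a.
  rewrite mulrDr mulrA divfK // -addrA; congr (_ + _).
  rewrite mulr_sumr -big_split /=; apply: eq_bigr => k _; rewrite !mxE -/a.
  by field.
have bd (z : 'cV[R]_q.+1) : `|z| <= eta -> `|(A *m z) i0 0| <= q.+1%:R * `|a| * eta.
  move=> ze; rewrite mxE; apply: le_trans (ler_norm_sum _ _ _) _.
  apply: le_trans (_ : \sum_(k < q.+1) `|a| * eta <= _); last first.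
    by rewrite sumr_const card_ord -[leLHS]mulr_natl mulrA.
  apply: ler_sum => k _; rewrite normrM ler_pM //.
  exact: le_trans (mx_norm_entry _ _ _) ze.
have d0 := c0P _ _ (bd _ xe) (bd _ ye) e0.
have d1 := cP _ _ (le_trans (norm_row' _ _) xe) (le_trans (norm_row' _ _) ye) e1.
apply: mx_norm_le => [|i j]; first by rewrite !mulr_ge0 // ltW.
rewrite ord1 {j} mxBE (dec x i) (dec y i).
set X := (A *m x) i0 0 in d0 *; set Y := (A *m y) i0 0 in d0 *.
have -> : A i j0 / a * X + (schur A i0 j0 *m row' j0 x) i 0 -
    (A i j0 / a * Y + (schur A i0 j0 *m row' j0 y) i 0) =
  A i j0 / a * (X - Y) +
    (schur A i0 j0 *m row' j0 x - schur A i0 j0 *m row' j0 y) i 0.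
  by rewrite mxBE; ring.
apply: le_trans (ler_normD _ _) _.
apply: le_trans (_ : eta + 2 * q%:R * eta <= _); last first.
  by rewrite -[q.+1%:R]natr1; nra.
apply: lerD; last exact: le_trans (mx_norm_entry _ _ _) d1.
rewrite normrM -[eta]mul1r ler_pM //.
by rewrite normrM normfV ler_pdivrMr // mul1r amax.
Qed.

End Minors.

(** * Operator norms, minors and exterior powers *)

Section Opnorm.
Context {R : realType}.

Lemma enorm_le n (x : 'cV[R]_n) : enorm x <= Num.sqrt n%:R * `|x|.
Proof.
rewrite /enorm -[X in _ * X]normr_id -sqrtr_sqr -sqrtrM //; apply: ler_wsqrtr.
apply: le_trans (_ : \sum_(i < n) `|x| ^+ 2 <= _).
  by apply: ler_sum => i _; rewrite -real_normK ?num_real // lerXn2r // ?nnegrE //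
    mx_norm_entry.
by rewrite sumr_const card_ord -[leLHS]mulr_natl.
Qed.

Lemma entry_enorm n (x : 'cV[R]_n) i : `|x i 0| <= enorm x.
Proof.
rewrite -sqrtr_sqr /enorm; apply: ler_wsqrtr.
by rewrite (bigD1 i) //= lerDl sumr_ge0 // => j _; exact: sqr_ge0.
Qed.

Lemma enorm_ge0 n (x : 'cV[R]_n) : 0 <= enorm x.
Proof. exact: sqrtr_ge0. Qed.

Lemma mx_norm_enorm n (x : 'cV[R]_n) : `|x| <= enorm x.
Proof.
by apply: mx_norm_le => [|i j]; [exact: enorm_ge0|rewrite ord1 entry_enorm].
Qed.

Lemma opnorm_ubound m n (A : 'M[R]_(m, n)) :
  ubound [set enorm (A *m x) | x in [set x | enorm x <= 1]]
    (Num.sqrt m%:R * (n%:R * `|A|)).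
Proof.
move=> _ [x /= x1 <-]; apply: le_trans (enorm_le _) _.
rewrite ler_wpM2l ?sqrtr_ge0 // -[leRHS]mulr1.
by apply: mx_norm_mul_le => //; apply: le_trans (mx_norm_enorm x) x1.
Qed.

Lemma opnorm_le m n (A : 'M[R]_(m, n)) :
  opnorm A <= Num.sqrt m%:R * (n%:R * `|A|).
Proof.
apply: ge_sup; last exact: opnorm_ubound.
exists (enorm (A *m 0)), 0 => //=.
by rewrite /enorm big1 ?sqrtr0 // => i _; rewrite mxE expr0n.
Qed.

Lemma entry_opnorm m n (A : 'M[R]_(m, n)) i j : `|A i j| <= opnorm A.
Proof.
apply: le_trans (_ : enorm (A *m delta_mx j 0) <= _).
  by have := entry_enorm (A *m delta_mx j 0) i; rewrite -colE mxE.
apply: ub_le_sup; first by exists (Num.sqrt m%:R * (n%:R * `|A|)); exact: opnorm_ubound.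
exists (delta_mx j 0) => //=; rewrite /enorm (bigD1 j) //= mxE !eqxx expr1n.
rewrite big1 ?addr0 ?sqrtr1 // => k /negbTE kj; by rewrite mxE kj expr0n.
Qed.

Lemma opnorm_ge0 m n (A : 'M[R]_(m, n)) : 0 <= opnorm A.
Proof.
apply: le_trans (enorm_ge0 (A *m 0)) _.
apply: ub_le_sup; first by exists (Num.sqrt m%:R * (n%:R * `|A|)); exact: opnorm_ubound.
by exists 0 => //=; rewrite /enorm big1 ?sqrtr0 // => i _; rewrite mxE expr0n.
Qed.

Lemma mx_norm_opnorm m n (A : 'M[R]_(m, n)) : `|A| <= opnorm A.
Proof. by apply: mx_norm_le => [|i j]; [exact: opnorm_ge0|exact: entry_opnorm]. Qed.

Lemma injective_incr d k (I : 'I_k -> 'I_d) : injective I ->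
  exists s : 'S_k, finfun (fun i => I (s i)) \in incr_idx d k.
Proof.
move=> Iinj; pose t := [tuple I i | i < k].
pose le := fun i j : 'I_d => (i <= j)%N.
have /tuple_permP[s sE] : perm_eq (sort le t) t by rewrite perm_sort.
have srt : sorted ltn [seq val i | i <- sort le t].
  have -> : [seq val i | i <- sort le t] = sort leq (map val t).
    by rewrite -sort_map.
  rewrite ltn_sorted_uniq_leq sort_uniq sort_sorted ?andbT; last exact: leq_total.
  rewrite map_inj_uniq; last exact: val_inj.
  by rewrite map_inj_uniq // ?enum_uniq.
exists s; rewrite inE; apply/forallP => i; apply/forallP => j; apply/implyP => ij.
rewrite !ffunE.
have E (a : 'I_k) : nth 0%N [seq val i | i <- sort le t] a = I (s a).
  rewrite sE /= (nth_map (I a)) ?size_map -?enumT ?size_enum_ord //.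
  by rewrite (nth_map a) ?size_enum_ord // nth_ord_enum tnth_mktuple.
rewrite -!E; apply: (sorted_ltn_nth ltn_trans) => //;
  by rewrite inE size_map size_sort size_tuple.
Qed.

(** A repeated row or column makes the minor vanish. Otherwise k <= d, and sorting rows and columns
    changes only the sign, so the minor is up to sign an entry of [extpow k A]. *)
Lemma minors_le_incr d (A : 'M[R]_d) (M : R) : 0 <= M ->
  (forall k, (k <= d)%N -> opnorm (extpow k A) <= M) -> minors_le A M.
Proof.
move=> M0 AM k I J.
have [Iinj|/injectiveP/injectivePn[i [j ij eij]]] := pselect (injective I); last first.
  by rewrite (determinant_alternate ij) ?normr0 // => l; rewrite !mxE eij.
have [Jinj|/injectiveP/injectivePn[i [j ij eij]]] := pselect (injective J); last first.
  by rewrite -det_tr (determinant_alternate ij) ?normr0 // => l; rewrite !mxE eij.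
have [s sI] := injective_incr Iinj; have [t tJ] := injective_incr Jinj.
have kd : (k <= d)%N by have := leq_card _ Iinj; rewrite !card_ord.
apply: le_trans (AM k kd).
have := entry_opnorm (extpow k A) (enum_rank_in sI (finfun (fun i => I (s i))))
  (enum_rank_in tJ (finfun (fun i => J (t i)))).
rewrite mxE !enum_rankK_in //.
have -> : mxsub (finfun (fun i => I (s i))) (finfun (fun i => J (t i))) A =
   row_perm s (col_perm t (mxsub I J A)).
  by apply/matrixP => i j; rewrite !mxE !ffunE.
by rewrite row_permE col_permE !det_mulmx !det_perm !normrM !normr_sign mul1r mulr1.
Qed.

Lemma opnorm_extpow0 d (A : 'M[R]_d) : 1 <= opnorm (extpow 0 A).
Proof.
have [I0 I0P] : exists I0, I0 \in incr_idx d 0.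
  by exists (ffun0 (card_ord 0)); rewrite inE; apply/forallP => -[].
apply: le_trans (entry_opnorm _ (enum_rank_in I0P I0) (enum_rank_in I0P I0)).
by rewrite mxE det_mx00 normr1.
Qed.

End Opnorm.

Section Normalization.
Context {R : realType}.

Lemma norm_colsub1 m d (J : 'I_m -> 'I_d) : `|colsub J (1%:M : 'M[R]_d)| <= 1.
Proof.
by apply: mx_norm_le => // i j; rewrite !mxE; case: eqP; rewrite ?normr1 ?normr0.
Qed.

(* A choice of m columns maximizing the minor makes, by Cramer's rule, all
   entries at most 1 in modulus. *)
Lemma row_free_normalize m d (P : 'M[R]_(m, d)) : row_free P ->
  exists2 G : 'M[R]_m, G \in unitmx &
  exists2 J : {ffun 'I_m -> 'I_d}, G *m P *m colsub J 1%:M = 1%:M & `|G *m P| <= 1.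
Proof.
move=> Pfree; have Pfull : row_full P^T by rewrite /row_full mxrank_tr.
pose minor (J : {ffun 'I_m -> 'I_d}) := \det (colsub J P).
have minor_frf : minor (fullrankfun Pfull) != 0.
  by rewrite /minor -det_tr trmx_mxsub -unitfE -unitmxE fullrowsub_unit.
have [J _ Jmax] := arg_maxP (fun J => `|minor J|) (erefl : xpredT (fullrankfun Pfull)).
have J0 : minor J != 0.
  by rewrite -normr_gt0; apply: lt_le_trans (Jmax (fullrankfun Pfull) isT); rewrite normr_gt0.
have Bu : colsub J P \in unitmx by rewrite unitmxE unitfE.
exists (invmx (colsub J P)); first by rewrite unitmx_inv.
have GJ : invmx (colsub J P) *m P *m colsub J 1%:M = 1%:M.
  by rewrite -mulmxA mulmx_colsub mulmx1 mulVmx.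
exists J => //; apply: mx_norm_le => // i j.
pose J' := finfun (fun l => if l == i then j else J l).
have : `|minor J'| <= `|minor J| by exact: Jmax.
set g := invmx _ *m P.
have gJ k l : g k (J l) = (k == l)%:R.
  have := congr1 (fun B : 'M[R]_m => B k l) GJ.
  by rewrite mulmx_colsub mulmx1 !mxE.
have -> : minor J' = minor J * g i j.
  have PJ' : colsub J' P = colsub J P *m colsub J' g.
    by rewrite mulmx_colsub /g mulmxA mulmxV // mul1mx.
  (* [colsub J' g] differs from the identity only in column i, so its determinant is its diagonal
     entry [g i j]. *)
  clearbody g; rewrite /minor PJ' det_mulmx; congr (_ * _).
  rewrite (expand_det_row _ i) (bigD1 i) //= big1.
    rewrite addr0 mxE ffunE eqxx /cofactor addnn -mul2n exprM sqrrN !expr1n mul1r.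
    rewrite (_ : row' _ _ = 1%:M) ?det1 ?mulr1 //.
    apply/matrixP => k l; rewrite !mxE ffunE eq_sym (negbTE (neq_lift _ _)) gJ.
    by rewrite (inj_eq lift_inj).
  by move=> l /negbTE li; rewrite mxE ffunE li gJ eq_sym li mul0r.
by rewrite normrM ger_pMr ?normr_gt0.
Qed.
End Normalization.

(** * Cylinders and tangent cones *)

Lemma invmx_mul (K : fieldType) n (A B : 'M[K]_n) : A \in unitmx ->
  B \in unitmx -> invmx (A *m B) = invmx B *m invmx A.
Proof.
move=> Au Bu; have ABu : A *m B \in unitmx by rewrite unitmx_mul Au.
rewrite -[RHS](mulmxK ABu) -(mulmxA (invmx B)) (mulmxA (invmx A)) mulVmx //.
by rewrite mul1mx mulVmx // mul1mx.
Qed.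

Section Tangent.
Context {R : realType} {d : nat}.
Implicit Types (l : seq ('rV[R]_d * R)) (x u : 'cV[R]_d).

Definition sat l x := forall c, c \in l -> (c.1 *m x) 0 0 < c.2.

(* u is a tangent direction at x of the polytope [sat l], and the tangent cone
   at x is invariant under translations by the kernel of P. *)
Definition tangent m (P : 'M[R]_(m, d)) l x u := forall c, c \in l ->
  (c.1 *m x) 0 0 < c.2 \/
  [/\ (c.1 *m x) 0 0 = c.2, (c.1 <= P)%MS & (c.1 *m u) 0 0 < 0].

Lemma affineE (a : 'rV[R]_d) x t u :
  (a *m (x + t *: u)) 0 0 = (a *m x) 0 0 + t * (a *m u) 0 0.
Proof. by rewrite mulmxDr -scalemxAr !mxE. Qed.

Lemma small_step l x u : exists2 t : R, 0 < t &
  forall c, c \in l -> (c.1 *m x) 0 0 < c.2 -> (c.1 *m (x + t *: u)) 0 0 < c.2.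
Proof.
(* Asking for all shorter steps as well lets the induction take minima. *)
suff [t t0 H] : exists2 t : R, 0 < t & forall s, 0 < s <= t -> forall c, c \in l ->
    (c.1 *m x) 0 0 < c.2 -> (c.1 *m (x + s *: u)) 0 0 < c.2.
  by exists t => //; apply: H; rewrite t0 lexx.
elim: l => [|c l [t t0 IH]]; first by exists 1.
have [cx|cx] := ltP ((c.1 *m x) 0 0) c.2; last first.
  exists t => // s st c'; rewrite inE => /orP[/eqP ->|/IH]; last exact.
  by rewrite ltNge cx.
set e := c.2 - (c.1 *m x) 0 0; have e0 : 0 < e by rewrite subr_gt0.
have D0 : 0 < 1 + `|(c.1 *m u) 0 0| by rewrite ltr_pwDl.
exists (Num.min t (e / (1 + `|(c.1 *m u) 0 0|))).
  by rewrite lt_min t0 divr_gt0.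
move=> s; rewrite le_min => /and3P[s0 st se] c'; rewrite inE.
case/orP => [/eqP -> _|c'l]; last by apply: IH => //; rewrite s0.
rewrite affineE -ltrBrDl -/e; apply: le_lt_trans (_ : s * `|(c.1 *m u) 0 0| < _).
  by rewrite ler_pM2l // ler_norm.
by move: se; rewrite ler_pdivlMr //; apply: lt_le_trans; rewrite ltr_pM2l // ltrDr.
Qed.

(** A small step from x along u enters the polytope. This yields an actual orbit in a cylinder known
    only through its tangent cone, which the distortion bounds require. *)
Lemma tangent_sat m (P : 'M[R]_(m, d)) l x u : tangent P l x u ->
  exists y, sat l y.
Proof.
move=> T; have [t t0 H] := small_step l x u.
exists (x + t *: u) => c cl; have [/(H c cl) //|[cx _ cu]] := T c cl.
by rewrite affineE cx gtrDl pmulr_rlt0.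
Qed.

Lemma tangentZ m (P : 'M[R]_(m, d)) l x u r : 0 < r ->
  tangent P l x u -> tangent P l x (r *: u).
Proof.
move=> r0 T c cl; have [|[? ? cu]] := T c cl; [by left|right; split => //].
by rewrite -scalemxAr mxE pmulr_rlt0.
Qed.

Lemma tangent_eqmx m n (P : 'M[R]_(m, d)) (Q : 'M[R]_(n, d)) l x u :
  (P <= Q)%MS -> tangent P l x u -> tangent Q l x u.
Proof.
move=> PQ T c cl; have [|[? cP ?]] := T c cl; [by left|right; split => //].
exact: submx_trans cP PQ.
Qed.

Definition pullback (A : 'M[R]_d) (t : 'cV[R]_d) (c : 'rV[R]_d * R) :=
  (c.1 *m A, c.2 - (c.1 *m t) 0 0).

Lemma sat_pullback (A : 'M[R]_d) t l x :
  sat (map (pullback A t) l) x <-> sat l (A *m x + t).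
Proof.
have E (c : 'rV[R]_d * R) : ((pullback A t c).1 *m x) 0 0 < (pullback A t c).2 =
    ((c.1 *m (A *m x + t)) 0 0 < c.2).
  by rewrite /= mulmxDr mulmxA [in RHS]mxE ltrBrDr.
split=> [H c cl|H _ /mapP[c cl ->]]; last by rewrite E; exact: H.
by rewrite -E; apply: H; exact: map_f.
Qed.

(** The kernel of [P *m invmx A] is the image under A of the kernel of P, so the invariant subspace
    travels with the point and the direction. *)
Lemma tangent_pullback m (P : 'M[R]_(m, d)) (A : 'M[R]_d) t l x u :
  A \in unitmx -> tangent P (map (pullback A t) l) x u ->
  tangent (P *m invmx A) l (A *m x + t) (A *m u).
Proof.
move=> Au T c cl; have := T _ (map_f (pullback A t) cl).
have E : (c.1 *m (A *m x + t)) 0 0 = (c.1 *m A *m x) 0 0 + (c.1 *m t) 0 0.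
  by rewrite mulmxDr mulmxA [in LHS]mxE.
rewrite E /= => -[cx|[cx cP cu]]; [left|right; split].
- by rewrite -ltrBrDr.
- by rewrite cx subrK.
- by rewrite -[c.1](mulmxK Au) submxMr.
- by rewrite mulmxA.
Qed.

End Tangent.

Section Words.
Context {R : realType} {d : nat} (f : paff R d)
  (cs : 'I_(npieces f) -> seq ('rV[R]_d * R))
  (csP : forall i x, piece f i x <-> sat (cs i) x)
  (fnd : paff_nondegenerate f).
Implicit Types (w : seq 'I_(npieces f)) (x y u : 'cV[R]_d).

(** [wcs], [wlin] and [wmap] follow the affine extensions of the branches along w, so they make
    sense at boundary points, where [f] itself selects no word. *)
Fixpoint wcs w := if w is i :: w' then
  cs i ++ map (pullback (linpart f i) (transl f i)) (wcs w') else [::].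

Fixpoint wlin w : 'M[R]_d := if w is i :: w' then wlin w' *m linpart f i else 1%:M.

Fixpoint wmap w x := if w is i :: w' then wmap w' (linpart f i *m x + transl f i)
  else x.

Fixpoint itin w x := if w is i :: w' then piece f i x /\ itin w' (f x) else True.

Lemma wlin_unit w : wlin w \in unitmx.
Proof.
by elim: w => [|i w IH] /=; [exact: unitmx1|rewrite unitmx_mul IH; exact: fnd].
Qed.

Lemma wmapB w x y : wmap w x - wmap w y = wlin w *m (x - y).
Proof.
elim: w x y => [|i w IH] x y /=; first by rewrite mul1mx.
by rewrite IH opprD addrACA subrr addr0 -mulmxBr mulmxA.
Qed.

Lemma sat_cat l1 l2 x : @sat R d (l1 ++ l2) x <-> sat l1 x /\ sat l2 x.
Proof.
split=> [H|[H1 H2] c]; last by rewrite mem_cat => /orP[/H1|/H2].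
by split=> c cl; apply: H; rewrite mem_cat cl ?orbT.
Qed.

Lemma sat_wcs w x : sat (wcs w) x <-> itin w x.
Proof.
elim: w x => [|i w IH] x /=; first by split.
rewrite sat_cat sat_pullback -csP; split=> -[xi]; rewrite -(pmap_affine xi).
  by rewrite IH.
by rewrite IH.
Qed.

Lemma tangent_wcs_cat m (P : 'M[R]_(m, d)) w1 w2 x u :
  tangent P (wcs (w1 ++ w2)) x u -> tangent P (wcs w1) x u /\
  tangent (P *m invmx (wlin w1)) (wcs w2) (wmap w1 x) (wlin w1 *m u).
Proof.
elim: w1 m P x u => [|i w1 IH] m P x u /=.
  by move=> T; split=> [c //|]; rewrite invmx1 mulmx1 mul1mx.
move=> T; have T1 : tangent P (cs i) x u.
  by move=> c cl; apply: T; rewrite mem_cat cl.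
have /(tangent_pullback (fnd i))/IH[T2 T3] : tangent P
    (map (pullback (linpart f i) (transl f i)) (wcs (w1 ++ w2))) x u.
  by move=> c cl; apply: T; rewrite mem_cat cl orbT.
split.
  move=> c; rewrite mem_cat => /orP[/T1 //|/mapP[c' c'l ->]].
  have E : ((c'.1 *m (linpart f i *m x + transl f i)) 0 0 =
      (c'.1 *m linpart f i *m x) 0 0 + (c'.1 *m transl f i) 0 0).
    by rewrite mulmxDr mulmxA [in LHS]mxE.
  have := T2 c' c'l; rewrite E /= => -[cx|[cx cP cu]]; [left|right; split].
  - by rewrite ltrBrDr.
  - by rewrite -cx addrK.
  - by rewrite -[P](mulmxKV (fnd i)) submxMr.
  - by rewrite -mulmxA.
by rewrite invmx_mul ?wlin_unit // mulmxA -[X in tangent _ _ _ X]mulmxA.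
Qed.

Lemma itin_cat w1 w2 x : itin (w1 ++ w2) x <->
  itin w1 x /\ itin w2 (iter (size w1) f x).
Proof.
elim: w1 x => [|i w1 IH] x; first by split=> [|[]].
by rewrite [size _]/= iterSr /= IH; tauto.
Qed.

Lemma itin_wmap w x : itin w x -> iter (size w) f x = wmap w x.
Proof.
elim: w x => [//|i w IH] x; rewrite [size _]/= iterSr /= => -[xi /IH ->].
by rewrite (pmap_affine xi).
Qed.

Lemma iter_dom_itin n x : iter_dom f n x <-> exists2 w, size w = n & itin w x.
Proof.
split; last first.
  move=> [w <-]; elim: w x => [|i w IH] x /=; first by move=> _ k.
  move=> [xi /IH H] [_|k]; first by exists i.
  by rewrite ltnS iterSr => /H.
elim: n x => [|n IH] x H; first by exists [::].
have [i _ xi] := H 0%N isT.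
have [k kn|w sw wx] := IH (f x); last by exists (i :: w); rewrite /= ?sw.
by rewrite -iterSr; exact: H.
Qed.

Lemma diff_at_piece i x : piece f i x -> diff_at f x = linpart f i.
Proof.
move=> xi; rewrite /diff_at; case: pickP => [j|/(_ i)]; last first.
  by rewrite mem_set.
rewrite inE => xj; have [->//|ji] := eqVneq j i.
by have := piece_disjoint ji; rewrite -subset0 => /(_ x); case.
Qed.

Lemma itin_uniq w w' x : itin w x -> itin w' x -> size w = size w' -> w = w'.
Proof.
elim: w w' x => [|i w IH] [|j w'] x //= [xi wx] [xj w'x] [sw].
have [->|ij] := eqVneq i j; first by rewrite (IH w' (f x)).
by have := piece_disjoint ij; rewrite -subset0 => /(_ x); case.
Qed.

Lemma itin_diff w x : itin w x -> diff_iter f (size w) x = wlin w.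
Proof.
(* [diff_iter] splits off the last factor and [wlin] the first one. *)
suff E n y : diff_iter f n.+1 y = diff_iter f n (f y) *m diff_at f y.
  elim: w x => [//|i w IH] x; rewrite [size _]/= E /= => -[xi /IH ->].
  by rewrite (diff_at_piece xi).
elim: n => [|n IH]; first by rewrite /= mulmx1 mul1mx.
by rewrite -[LHS]/(diff_at f (iter n.+1 f y) *m diff_iter f n.+1 y) IH iterSr mulmxA.
Qed.

End Words.

(** * Finite systems of inequalities on compact sets *)

Section FiniteCompactness.
Context {R : realType}.

(* A finite system of weak inequalities that fails everywhere on a compact set
   fails uniformly. *)
Lemma compact_system (T : topologicalType) (K : set T) (V : eqType) (L : seq V)
    (phi : V -> T -> R) : compact K -> (forall c, continuous (phi c)) ->
  exists2 eta : R, 0 < eta & forall (G : V -> Prop) z, K z ->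
    (forall c, c \in L -> G c -> phi c z <= eta) ->
    exists2 u, K u & forall c, c \in L -> G c -> phi c u <= 0.
Proof.
move=> Kc cphi.
have [[z0 Kz0]|K0] := pselect (K !=set0); last first.
  by exists 1 => // G z Kz; case: K0; exists z.
(* Twice the sum of the positive parts over the subsystem selected by m; it vanishes exactly where
   this subsystem holds. *)
pose psi (m : seq bool) z : R := \sum_(c <- mask m L) (phi c z + `|phi c z|).
have cpsi m : continuous (psi m).
  move=> z; apply: cvg_big => [|c _]; first exact: add_continuous.
  by apply: cvgD; [exact: cphi|apply: cvg_norm; exact: cphi].
have one (m : seq bool) : exists2 eta : R, 0 < eta & forall z, K z ->
    (forall c, c \in mask m L -> phi c z <= eta) ->
    exists2 u, K u & forall c, c \in mask m L -> phi c u <= 0.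
  have [u] := compact_EVT_min (ex_intro _ _ Kz0) Kc (continuous_subspaceT (cpsi m)).
  rewrite inE => Ku umin.
  have t0 c z : 0 <= phi c z + `|phi c z|.
    by rewrite -lerBlDl sub0r -normrN ler_norm.
  have [psi0|psi0] := leP (psi m u) 0.
    exists 1 => // _ _ _; exists u => // c cm.
    have : phi c u + `|phi c u| <= 0.
      apply: le_trans psi0; rewrite /psi (big_rem c) //= lerDl.
      exact: sumr_ge0.
    by have := normr_ge0 (phi c u); lra.
  (* If every inequality held up to this value at z, then [psi m z] would be below its positive
     minimum. *)
  exists (psi m u / (2 * (size (mask m L))%:R + 1)) => [|z Kz zm].
    by rewrite divr_gt0 // ltr_pwDr // mulr_ge0.
  have : psi m u <= psi m z by apply: umin; rewrite inE.
  set eta := _ / _ in zm.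
  have eta0 : 0 < eta by rewrite divr_gt0 // ltr_pwDr // mulr_ge0.
  have : psi m z <= \sum_(c <- mask m L) 2 * eta.
    rewrite /psi !big_seq; apply: ler_sum => c /zm cz.
    by have [/ger0_norm|/ltr0_norm] := leP 0 (phi c z); lra.
  rewrite big_const_seq count_predT iter_addr_0 -mulr_natl => h1 h2.
  have := le_trans h2 h1.
  rewrite {1}(_ : psi m u = eta * (2 * (size (mask m L))%:R + 1)); first by lra.
  by rewrite divfK // gt_eqF // ltr_pwDr // mulr_ge0.
have /choice[e eP] : forall m, exists e : R, 0 < e /\ forall z, K z ->
    (forall c, c \in mask m L -> phi c z <= e) ->
    exists2 u, K u & forall c, c \in mask m L -> phi c u <= 0.
  by move=> m; have [e e0 eH] := one m; exists e.
(* The minimum over all subsystems makes eta independent of G. *)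
pose eta := \big[Num.min/1]_(m : (size L).-tuple bool) e m.
exists eta => [|G z Kz H].
  by apply: lt_bigmin => // m _; case: (eP m).
pose m := [tuple of [seq `[< G c >] | c <- in_tuple L]].
have mL c : c \in mask m L <-> c \in L /\ G c.
  rewrite /= -filter_mask mem_filter; split=> [/andP[/asboolP]|[? ?]] //.
  by apply/andP; split => //; exact/asboolP.
have [_] := eP m.
case/(_ z Kz) => [c /mL[cL cG]|u Ku uP]; last first.
  by exists u => // c cL cG; apply: uP; apply/mL.
by apply: le_trans (H c cL cG) _; exact: (bigmin_le 1 m (fun m => e m)).
Qed.

Lemma continuous_linear_form n (c : 'rV[R]_n) (b : R) :
  continuous (fun x : 'cV[R]_n => (c *m x) 0 0 - b).
Proof.
move=> x; apply: (@continuousB R R^o); last exact: cst_continuous.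
under [X in {for x, continuous X}]eq_fun do rewrite mxE.
apply: continuous_big => [|i _ y]; first exact: add_continuous.
by apply: continuousM; [exact: cst_continuous|exact: coord_continuous].
Qed.

Lemma continuous_linear_form_tr n (c : 'rV[R]_n) :
  continuous (fun x : 'rV[R]_n => (c *m x^T) 0 0).
Proof.
under [X in continuous X]eq_fun do rewrite mxE.
apply: continuous_big => [|i _ y]; first exact: add_continuous.
apply: continuousM; first exact: cst_continuous.
by under [X in {for y, continuous X}]eq_fun do rewrite mxE; exact: coord_continuous.
Qed.

Lemma mx_norm_tr m n (A : 'M[R]_(m, n)) : `|A^T| = `|A|.
Proof.
apply/eqP; rewrite eq_le; apply/andP; split; apply: mx_norm_le => // i j.
  by rewrite mxE mx_norm_entry.
by have := mx_norm_entry A^T j i; rewrite mxE.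
Qed.

Lemma compact_sphere n : compact [set x : 'rV[R]_n | `|x| = 1].
Proof.
apply: bounded_closed_compact.
  by exists 1; split => // M M1 x /= ->; exact: ltW.
have -> : [set x : 'rV[R]_n | `|x| = 1] = (Num.norm : _ -> R) @^-1` [set 1] by [].
by apply: preimage_closed => //; move=> x _; exact: norm_continuous.
Qed.

Lemma sphere_system n (L : seq 'rV[R]_n) :
  exists2 eta : R, 0 < eta & forall (G : 'rV[R]_n -> Prop) (z : 'cV[R]_n),
    `|z| = 1 -> (forall c, c \in L -> G c -> (c *m z) 0 0 <= eta) ->
    exists2 u : 'cV[R]_n, `|u| = 1 &
      forall c, c \in L -> G c -> (c *m u) 0 0 <= 0.
Proof.
have [eta eta0 H] := compact_system L (@compact_sphere n)
  (@continuous_linear_form_tr n).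
exists eta => // G z z1 Hz.
case: (H G z^T) => [|c cL cG|u u1 uP]; first by rewrite /= mx_norm_tr.
  by rewrite trmxK; exact: Hz.
by exists u^T => //; rewrite mx_norm_tr.
Qed.

End FiniteCompactness.

(** * Growth of multiplicities *)

Section UnitVectors.
Context {R : realType}.

Lemma norm_unit_diff n (x y : 'cV[R]_n) : 0 < `|x| -> 0 < `|y| ->
  `| `|x|^-1 *: x - `|y|^-1 *: y| <= 2 * `|x - y| / `|x|.
Proof.
move=> x0 y0.
have -> : `|x|^-1 *: x - `|y|^-1 *: y =
    `|x|^-1 *: (x - y) + (`|x|^-1 - `|y|^-1) *: y.
  by rewrite scalerBr scalerBl addrA subrK.
apply: le_trans (ler_normD _ _) _.
rewrite !mx_normZ ger0_norm ?invr_ge0 // mulrC -mulrA mulr_natl mulr2n lerD2l.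
rewrite -[X in _ * X <= _]gtr0_norm // -normrM mulrBl mulVf ?gt_eqF //.
have -> : `|x|^-1 * `|y| - 1 = (`|y| - `|x|) / `|x| by field; rewrite gt_eqF.
rewrite normrM [X in _ * X]ger0_norm ?invr_ge0 // ler_pM2r ?invr_gt0 //.
by rewrite distrC ler_dist_dist.
Qed.

(** The rows of Q span the annihilator of u. If u is the image under P of a direction, the kernel of
    [Q *m P] is that of P enlarged by this direction, and the codimension drops by one. *)
Lemma kernel_rows m (u : 'cV[R]_m.+1) : u != 0 ->
  exists2 Q : 'M[R]_(m, m.+1), row_free Q &
    forall c : 'rV[R]_m.+1, c *m u = 0 -> (c <= Q)%MS.
Proof.
move=> u0; have rk : \rank (kermx u) = m.
  rewrite mxrank_ker; suff -> : \rank u = 1%N by rewrite subn1.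
  by apply/eqP; rewrite eqn_leq rank_leq_col lt0n mxrank_eq0.
have := row_base_free (kermx u); have := eq_row_base (kermx u).
move: (row_base (kermx u)); rewrite rk => Q Qe Qf; exists Q => // c cu.
by rewrite Qe sub_kermx cu.
Qed.

Lemma rV_norm_bound n (L : seq 'rV[R]_n) :
  exists2 D : R, 0 < D & forall c, c \in L -> `|c| <= D.
Proof.
elim: L => [|c L [D D0 H]]; first by exists 1.
exists (`|c| + D) => [|c']; first by rewrite ltr_wpDl.
by rewrite inE => /orP[/eqP ->|/H cD]; [rewrite lerDl ltW|rewrite ler_wpDl].
Qed.

End UnitVectors.

Section Multiplicity.
Context {R : realType} {d : nat} (f : paff R d)
  (cs : 'I_(npieces f) -> seq ('rV[R]_d * R))
  (csP : forall i x, piece f i x <-> sat (cs i) x)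
  (fnd : paff_nondegenerate f).
Implicit Types (w v : seq 'I_(npieces f)) (s : seq (seq 'I_(npieces f)))
  (x y u : 'cV[R]_d).

(* The number of n-cylinders adherent to x whose tangent cone at x is invariant
   under a given subspace of codimension m, the kernel of P, is at most B. *)
Definition multiplicity_le m n (B : R) := forall x (P : 'M[R]_(m, d)) s,
  row_free P -> uniq s ->
  (forall w, w \in s -> size w = n /\ exists u, tangent P (wcs cs w) x u) ->
  (size s)%:R <= B.

Lemma all_equal_size (T : eqType) (l : seq T) : uniq l ->
  (forall a b, a \in l -> b \in l -> a = b) -> (size l <= 1)%N.
Proof.
case: l => [|a [|b l]] //= /andP[+ _] H.
by rewrite (H a b) ?inE ?eqxx ?orbT.
Qed.

(** With no rows in P an active constraint would have normal 0 and could not decrease along u. So x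
    satisfies all constraints strictly and lies in the cylinders themselves. *)
Lemma multiplicity_le0 n : multiplicity_le 0 n 1.
Proof.
move=> x P s _ us H; rewrite (ler_nat _ _ 1).
apply: all_equal_size => // w w' /H[sw [u T]] /H[sw' [u' T']].
have I v u0 : tangent P (wcs cs v) x u0 -> itin v x.
  move=> Tv; apply/(sat_wcs csP) => c /Tv[//|[_ cP]].
  have -> : c.1 = 0.
    by apply/eqP; rewrite -submx0; apply: submx_trans cP _; rewrite flatmx0 sub0mx.
  by rewrite mul0mx mxE ltxx.
by apply: (@itin_uniq _ _ f _ _ x); [exact: I T|exact: I T'|rewrite sw sw'].
Qed.

(* By compactness, n-cylinders with nearby tangent directions at x share a
   tangent direction u0; they are then adherent to a point x + t u0. *)
Lemma directional_multiplicity m n (B : R) : multiplicity_le m n B -> 0 <= B ->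
  exists2 eta : R, 0 < eta & forall x (P : 'M[R]_(m.+1, d))
    (J : {ffun 'I_m.+1 -> 'I_d}) s (u : seq 'I_(npieces f) -> 'cV[R]_d),
  P *m colsub J 1%:M = 1%:M -> uniq s ->
  (forall w, w \in s ->
    [/\ size w = n, tangent P (wcs cs w) x (u w) & `|P *m u w| = 1]) ->
  (forall w w', w \in s -> w' \in s -> `|P *m u w - P *m u w'| <= eta) ->
  (size s)%:R <= B.
Proof.
move=> multB B0.
(* An active normal in the row space of a normalized P equals [colsub J c.1 *m P]. Its coordinates
   thus lie in this finite list, although x and P range over infinite families. *)
pose L := [seq colsub J c.1 | J : {ffun 'I_m.+1 -> 'I_d} <- enum {: {ffun 'I_m.+1 -> 'I_d}},
  c : 'rV[R]_d * R <- flatten [seq wcs cs w | w <- map val (enum {: n.-tuple 'I_(npieces f)})]].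
have [e e0 eP] := sphere_system L; have [D D0 DP] := rV_norm_bound L.
exists (e / (m.+1%:R * D)) => [|x P J s u PJ us H close].
  by rewrite divr_gt0 // mulr_gt0.
have inL w c : size w = n -> c \in wcs cs w -> colsub J c.1 \in L.
  move=> sw cw; apply/allpairsP; exists (J, c); rewrite mem_enum; split=> //.
  apply/flattenP; exists (wcs cs w) => //; apply: map_f.
  by apply/mapP; exists (Tuple (introT eqP sw)); rewrite ?mem_enum.
case: s us H close => [|w0 s0] // us; set s := w0 :: s0 in us * => H close.
have w0s : w0 \in s by rewrite mem_head.
have actE (c : 'rV[R]_d) : (c <= P)%MS -> c = colsub J c *m P.
  move=> /submxP[b ->]; congr (_ *m _).
  by rewrite -[b in LHS]mulmx1 -PJ mulmxA mulmx_colsub mulmx1.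
(* The active normals of all words of s. Each is negative on the direction of its own word, hence at
   most e on that of [w0], and the system yields a common [u0]. *)
pose G (c : 'rV[R]_m.+1) := exists w a, [/\ w \in s, a \in wcs cs w,
  (a.1 *m x) 0 0 = a.2, (a.1 <= P)%MS & c = colsub J a.1].
have [_ _ z1] := H _ w0s.
have [|u0 u01 u0G] := eP G _ z1.
  move=> c cL [w [a [ws aw ax aP cE]]].
  have [_ /(_ a aw) Ta _] := H _ ws.
  case: Ta => [|[_ _ au]]; first by rewrite ax ltxx.
  have cu : (c *m (P *m u w)) 0 0 < 0 by rewrite mulmxA cE -actE.
  have -> : (c *m (P *m u w0)) 0 0 =
      (c *m (P *m u w)) 0 0 + (c *m (P *m u w0 - P *m u w)) 0 0.
    by rewrite mulmxBr mxBE addrC subrK.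
  apply: le_trans (_ : `|c *m (P *m u w0 - P *m u w)| <= _).
    have := mx_norm_entry (c *m (P *m u w0 - P *m u w)) 0 0.
    have := ler_norm ((c *m (P *m u w0 - P *m u w)) 0 0).
    by move: cu; lra.
  apply: le_trans (mx_norm_mul_le (DP _ cL) (close _ _ w0s ws)) _.
  by rewrite mulrC divfK // gt_eqF // mulr_gt0.
have u00 : u0 != 0 by rewrite -normr_gt0 u01.
have [Q Qf QP] := kernel_rows u00.
have [t t0 tP] := small_step (flatten [seq wcs cs w | w <- s]) x
  (colsub J 1%:M *m u0).
have Pf : row_free P by apply/row_freeP; exists (colsub J 1%:M).
(* After the step along [u0], inactive constraints stay strict and active ones become strict unless
   they vanish on [u0]. The latter have normals in the row space of [Q *m P] and still decrease
   along [u w]. *)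
apply: (multB (x + t *: (colsub J 1%:M *m u0)) (Q *m P)) => //.
  by rewrite /row_free mxrankMfree.
move=> w ws; have [sw T _] := H _ ws; split=> //; exists (u w) => a aw.
have [ax|[ax aP au]] := T a aw.
  by left; apply: tP => //; apply/flattenP; exists (wcs cs w) => //; exact: map_f.
have aJ : a.1 *m (colsub J 1%:M *m u0) = colsub J a.1 *m u0.
  by rewrite mulmxA mulmx_colsub mulmx1.
rewrite affineE aJ ax.
have : (colsub J a.1 *m u0) 0 0 <= 0.
  by apply: u0G; [exact: inL sw aw|exists w, a].
rewrite le_eqVlt => /orP[/eqP a0|a0]; last first.
  by left; rewrite gtrDl pmulr_rlt0.
right; split=> //; first by rewrite a0 mulr0 addr0.
rewrite (actE _ aP) submxMr // QP //.
by apply/matrixP => i j; rewrite !ord1 a0 mxE.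
Qed.

End Multiplicity.

Section LevelStep.
Context {R : realType} {d : nat} (f : paff R d)
  (cs : 'I_(npieces f) -> seq ('rV[R]_d * R))
  (csP : forall i x, piece f i x <-> sat (cs i) x)
  (fnd : paff_nondegenerate f).
Implicit Types (w v : seq 'I_(npieces f)) (s : seq (seq 'I_(npieces f)))
  (x y u : 'cV[R]_d).

Definition distortion_le n (kappa : R) := forall w x, size w = n -> itin w x ->
  `|wlin w| * `|invmx (wlin w)| <= kappa.

(** If [P *m u] vanishes, no constraint can be active at x, so every direction is tangent and any
    lift of a unit vector will do. *)
Lemma tangent_unit m (P : 'M[R]_(m.+1, d)) (S : 'M[R]_(d, m.+1)) l x u :
  P *m S = 1%:M -> tangent P l x u ->
  exists2 u', tangent P l x u' & `|P *m u'| = 1.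
Proof.
move=> PS T; have [Pu0|Pu0] := eqVneq (P *m u) 0; last first.
  have n0 : 0 < `|P *m u| by rewrite normr_gt0.
  exists (`|P *m u|^-1 *: u); first by apply: tangentZ => //; rewrite invr_gt0.
  by rewrite -scalemxAr mx_normZ gtr0_norm ?invr_gt0 // mulVf // gt_eqF.
exists (S *m delta_mx 0 0) => [c cl|].
  have [|[_ /submxP[b ->]]] := T c cl; first by left.
  by rewrite -mulmxA Pu0 mulmx0 mxE ltxx.
rewrite mulmxA PS mul1mx; apply/eqP; rewrite eq_le; apply/andP; split.
  by apply: mx_norm_le => // i j; rewrite mxE; case: (_ && _); rewrite ?normr1 ?normr0.
by apply: le_trans (mx_norm_entry _ 0 0); rewrite mxE !eqxx normr1.
Qed.

(* The linear map G intertwines the normalized coordinates before and after the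
   n-cylinder v has been traversed. *)
Lemma projective_distortion m n kappa v y (P P' : 'M[R]_(m.+1, d)) (G : 'M[R]_m.+1)
    (J J' : {ffun 'I_m.+1 -> 'I_d}) : distortion_le n kappa ->
  size v = n -> itin v y -> G \in unitmx ->
  P *m colsub J 1%:M = 1%:M -> `|P| <= 1 ->
  P' = G *m (P *m invmx (wlin v)) ->
  P' *m colsub J' 1%:M = 1%:M -> `|P'| <= 1 ->
  forall z1 z2 : 'cV[R]_m.+1, `|z1| = 1 -> `|z2| = 1 ->
  [/\ 0 < `|G *m z1|, 0 < `|G *m z2| &
  `| `|G *m z1|^-1 *: (G *m z1) - `|G *m z2|^-1 *: (G *m z2)| <=
    2 * ((m.+1%:R * d%:R ^+ 2) ^+ 2 * kappa) * `|z1 - z2|].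
Proof.
move=> dist sv vy Gu PJ P1 P'E PJ' P'1 z1 z2 z11 z21.
have vu := wlin_unit fnd v.
(* Both G and its inverse are products of normalized factors with [wlin v] or its inverse, whence
   the factor d^2 in each norm. *)
have GE : G = P' *m wlin v *m colsub J 1%:M.
  by rewrite P'E mulmxA mulmxKV // -mulmxA PJ mulmx1.
have VE : invmx G = P *m invmx (wlin v) *m colsub J' 1%:M.
  by rewrite -(mulKmx Gu (P *m _)) -P'E -mulmxA PJ' mulmx1.
have nG : `|G| <= d%:R ^+ 2 * `|wlin v|.
  rewrite {1}GE; apply: le_trans (mx_norm_mul_le (mx_norm_mul_le P'1 (lexx _))
    (norm_colsub1 J)) _.
  by rewrite !mulr1 mulrA -expr2.
have nV : `|invmx G| <= d%:R ^+ 2 * `|invmx (wlin v)|.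
  rewrite VE; apply: le_trans (mx_norm_mul_le (mx_norm_mul_le P1 (lexx _))
    (norm_colsub1 J')) _.
  by rewrite !mulr1 mulrA -expr2.
have low (z : 'cV[R]_m.+1) : `|z| = 1 ->
    1 <= m.+1%:R * (d%:R ^+ 2 * `|invmx (wlin v)|) * `|G *m z|.
  by move=> z1'; rewrite -{1}z1' -{1}(mulKmx Gu z) mx_norm_mul_le.
have pos (z : 'cV[R]_m.+1) : `|z| = 1 -> 0 < `|G *m z|.
  move=> /low; rewrite lt_neqAle normr_ge0 andbT eq_sym; apply: contraTneq => ->.
  by rewrite mulr0 ler10.
split; [exact: pos|exact: pos|].
apply: le_trans (norm_unit_diff (pos _ z11) (pos _ z21)) _.
rewrite -mulmxBr ler_pdivrMr ?pos //.
apply: le_trans (_ : 2 * ((m.+1%:R * d%:R ^+ 2) ^+ 2 * kappa * `|z1 - z2| *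
  `|G *m z1|) <= _); last by rewrite !mulrA.
rewrite ler_wpM2l //.
apply: le_trans (mx_norm_mul_le nG (lexx _)) _.
have := low _ z11; set g := `|G *m z1|; set dz := `|z1 - z2|.
have g0 : 0 < g by exact: pos.
have := dist v y sv vy; set a := `|wlin v|; set a' := `|invmx _| => aa h.
have a0 : 0 <= a by exact: normr_ge0.
have dz0 : 0 <= dz by exact: normr_ge0.
set D := d%:R ^+ 2 in h *; set M := m.+1%:R in h *.
have D0 : 0 <= D by exact: exprn_ge0.
have M0 : 0 <= M by exact: ler0n.
apply: le_trans (_ : M * (D * a) * dz * (M * (D * a') * g) <= _).
  by rewrite ler_peMr // !mulr_ge0.
have -> : M * (D * a) * dz * (M * (D * a') * g) =
   (M * D) ^+ 2 * dz * g * (a * a') by ring.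
have -> : (M * D) ^+ 2 * kappa * dz * g = (M * D) ^+ 2 * dz * g * kappa by ring.
by rewrite ler_wpM2l // !mulr_ge0 ?exprn_ge0 ?mulr_ge0 // ltW.
Qed.

(** The bound of [sphere_code] for cutting a part of radius 2 E kappa eta into cells of diameter
    eta, where E = ((m + 1) d^2)^2 comes from [projective_distortion]. *)
Definition projective_growth m (kappa : R) : R :=
  (m.+1 * 2)%:R * (4 * ((m.+1%:R * d%:R ^+ 2) ^+ 2 * kappa) + 1) ^+ m.

(** Induction on the number of blocks, with directions kept within eta. Such directions admit at
    most B first blocks v; v spreads them by its distortion, and they are cut again into cells of
    diameter eta. *)
Lemma directional_chain m n (B kappa eta : R) : 0 <= B -> 0 <= kappa -> 0 < eta ->
  distortion_le n kappa ->
  (forall x (P : 'M[R]_(m.+1, d)) (J : {ffun 'I_m.+1 -> 'I_d}) s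
      (u : seq 'I_(npieces f) -> 'cV[R]_d),
    P *m colsub J 1%:M = 1%:M -> uniq s ->
    (forall w, w \in s ->
      [/\ size w = n, tangent P (wcs cs w) x (u w) & `|P *m u w| = 1]) ->
    (forall w w', w \in s -> w' \in s -> `|P *m u w - P *m u w'| <= eta) ->
    (size s)%:R <= B) ->
  forall l x (P : 'M[R]_(m.+1, d)) (J : {ffun 'I_m.+1 -> 'I_d}) s
      (u : seq 'I_(npieces f) -> 'cV[R]_d),
    P *m colsub J 1%:M = 1%:M -> `|P| <= 1 -> uniq s ->
    (forall w, w \in s ->
      [/\ size w = (n * l)%N, tangent P (wcs cs w) x (u w) & `|P *m u w| = 1]) ->
    (forall w w', w \in s -> w' \in s -> `|P *m u w - P *m u w'| <= eta) ->
    (size s)%:R <= (B * projective_growth m kappa) ^+ l.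
Proof.
move=> B0 k0 eta0 dist step.
set C := projective_growth m kappa.
have C0 : 0 <= C by rewrite mulr_ge0 // exprn_ge0 // addr_ge0 // !mulr_ge0 // exprn_ge0.
elim=> [|l IH] x P J s u PJ P1 us H close.
  rewrite expr0 (ler_nat _ _ 1); apply: all_equal_size => // w w' /H[sw _ _] /H[sw' _ _].
  by rewrite (size0nil (etrans sw (muln0 n))) (size0nil (etrans sw' (muln0 n))).
have BCl0 : 0 <= C * (B * C) ^+ l by rewrite mulr_ge0 // exprn_ge0 // mulr_ge0.
have cut w : w \in s -> [/\ size (take n w) = n, size (drop n w) = (n * l)%N,
    tangent P (wcs cs (take n w)) x (u w) &
    tangent (P *m invmx (wlin (take n w))) (wcs cs (drop n w))
      (wmap (take n w) x) (wlin (take n w) *m u w)].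
  move=> /H[sw T _]; move: T; rewrite -{1}(cat_take_drop n w).
  case/(tangent_wcs_cat fnd) => T1 T2.
  have nw : (n <= size w)%N by rewrite sw mulnS leq_addr.
  by split=> //; rewrite ?size_takel // size_drop sw mulnS addKn.
rewrite exprS -mulrA; apply: (@size_fibers _ _ _ (take n)) => // [|v].
  (* One word of s represents each first block, so the distinct first blocks inherit close
     directions. *)
  pose pre v := nth [::] s (index v (map (take n) s)).
  have preP v : v \in undup (map (take n) s) -> pre v \in s /\ take n (pre v) = v.
    rewrite mem_undup => vs; have := vs; rewrite -index_mem size_map => ilt.
    by split; [exact: mem_nth|rewrite -(nth_map [::] [::]) // nth_index].
  apply: (step x P J _ (u \o pre)) => //; first exact: undup_uniq.
    move=> v /preP[ps pv]; have [sv _ T _] := cut _ ps; have [_ _ N] := H _ ps.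
    by rewrite -{1 2}pv; split.
  by move=> v v' /preP[ps _] /preP[ps' _]; exact: close.
set sv := [seq w <- s | take n w == v].
have svP w : w \in sv -> w \in s /\ take n w = v.
  by rewrite mem_filter => /andP[/eqP ? ?].
have [->|[w0 w0s]] : sv = [::] \/ exists w0, w0 \in sv.
  by case: {svP} sv => [|w0 sv']; [left|right; exists w0; rewrite mem_head].
  by [].
have [w0s' w0v] := svP _ w0s.
have [y /(sat_wcs csP) vy] : exists y, sat (wcs cs v) y.
  by have [_ _ T _] := cut _ w0s'; rewrite -w0v; exact: tangent_sat T.
have szv : size v = n by have [? _ _ _] := cut _ w0s'; rewrite -w0v.
have vu := wlin_unit fnd v.
(* The transported matrix is no longer normalized; a new column selection [J'] restores the
   hypotheses of the induction. *)
have Pf : row_free (P *m invmx (wlin v)).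
  apply/row_freeP; exists (wlin v *m colsub J 1%:M).
  by rewrite -mulmxA mulKmx // PJ.
have [G Gu [J' PJ' P'1]] := row_free_normalize Pf.
set P' := G *m (P *m invmx (wlin v)) in PJ' P'1.
have P'u w : P' *m (wlin v *m u w) = G *m (P *m u w).
  by rewrite /P' !mulmxA mulmxKV.
pose u' w := `|G *m (P *m u w)|^-1 *: (wlin v *m u w).
have D0 : 0 <= 2 * ((m.+1%:R * d%:R ^+ 2) ^+ 2 * kappa) * eta.
  by rewrite !mulr_ge0 ?exprn_ge0 ?mulr_ge0 // ltW.
have est w w' : w \in sv -> w' \in sv -> `|P' *m u' w| = 1 /\
    `|P' *m u' w - P' *m u' w'| <= 2 * ((m.+1%:R * d%:R ^+ 2) ^+ 2 * kappa) * eta.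
  move=> /svP[ws _] /svP[ws' _]; have [_ _ N] := H _ ws; have [_ _ N'] := H _ ws'.
  have [p p' D] := projective_distortion dist szv vy Gu PJ P1 (erefl P') PJ' P'1 N N'.
  rewrite /u' -!scalemxAr !P'u; split.
    by rewrite mx_normZ gtr0_norm ?invr_gt0 // mulVf // gt_eqF.
  apply: le_trans D _; rewrite ler_wpM2l ?close //.
  by rewrite !mulr_ge0 ?exprn_ge0 ?mulr_ge0.
have [T Tcard [c cP]] := sphere_code (P' *m u' w0) D0 eta0.
have TC : #|T|%:R <= C.
  apply: le_trans Tcard _; rewrite /C /projective_growth ler_wpM2l //.
  by rewrite !mulrA mulfK ?gt_eqF // -!mulrA (mulrA 2 2) -natrM.
apply: le_trans (_ : #|T|%:R * (B * C) ^+ l <= _); last first.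
  by rewrite ler_wpM2r // exprn_ge0 // mulr_ge0.
apply: (@size_fibers_fin _ _ _ (fun w => c (P' *m u' w))) => [|t].
  by rewrite exprn_ge0 // mulr_ge0.
set st := [seq w <- sv | _].
have stP w : w \in st -> w \in sv /\ c (P' *m u' w) = t.
  by rewrite mem_filter => /andP[/eqP ? ?].
have dropK w : w \in sv -> v ++ drop n w = w.
  by case/svP => _ {1}<-; exact: cat_take_drop.
rewrite -(size_map (drop n)).
have inE' w : w \in map (drop n) st -> v ++ w \in st.
  by case/mapP => w' w's ->; rewrite dropK //; case: (stP _ w's).
apply: (IH (wmap v x) P' J' _ (fun w => u' (v ++ w))) => //.
- rewrite map_inj_in_uniq; first by rewrite !filter_uniq.
  move=> w w' /stP[ws _] /stP[ws' _] e.
  by rewrite -(dropK _ ws) -(dropK _ ws') e.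
- move=> w /inE' /stP[ws _]; have [wss wv] := svP _ ws.
  have [_ sd _ T2] := cut _ wss; rewrite wv in T2.
  have dw : drop n (v ++ w) = w by rewrite drop_size_cat.
  rewrite dw in sd T2; split=> //; last by case: (est _ _ ws ws).
  apply: tangentZ; last first.
    by apply: tangent_eqmx T2; rewrite /P' (eqmxMfull _ (_ : row_full G)) ?row_full_unit.
  have [_ _ N] := H _ wss.
  by rewrite invr_gt0; have [] := projective_distortion dist szv vy Gu PJ P1 (erefl P') PJ' P'1 N N.
- move=> w w' /inE' /stP[ws cw] /inE' /stP[ws' cw'].
  have [n1 e1] := est _ _ ws w0s; have [n2 e2] := est _ _ ws' w0s.
  by apply: cP => //; rewrite cw cw'.
Qed.

(** Cutting the whole sphere once into cells of diameter eta starts [directional_chain]. The number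
    of these cells does not depend on l, so it stays outside the power. *)
Lemma multiplicity_step m n (B kappa : R) : 0 <= B -> 0 <= kappa ->
  multiplicity_le cs m n B -> distortion_le n kappa ->
  exists2 C : R, 0 < C & forall l,
    multiplicity_le cs m.+1 (n * l) (C * (B * projective_growth m kappa) ^+ l).
Proof.
move=> B0 k0 multB dist.
have [eta eta0 step] := directional_multiplicity multB B0.
have [T _ [c cP]] := @sphere_code _ m 1 eta 0 ler01 eta0.
exists (#|T|%:R + 1) => [|l x P0 s P0f us H0]; first by rewrite ltr_wpDl.
have [G Gu [J PJ P1]] := row_free_normalize P0f.
set P := G *m P0 in PJ P1.
have /choice[u H] : forall w, exists u, w \in s ->
    [/\ size w = (n * l)%N, tangent P (wcs cs w) x u & `|P *m u| = 1].
  move=> w; have [ws|nws] := boolP (w \in s); last by exists 0.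
  have [sw [u0 T0]] := H0 _ ws.
  have T1 : tangent P (wcs cs w) x u0.
    by apply: tangent_eqmx T0; rewrite /P (eqmxMfull _ (_ : row_full G)) ?row_full_unit.
  by have [u T2 N] := tangent_unit PJ T1; exists u.
have gr0 : 0 <= (B * projective_growth m kappa) ^+ l.
  rewrite exprn_ge0 // mulr_ge0 // mulr_ge0 // exprn_ge0 // addr_ge0 //.
  by rewrite !mulr_ge0 // exprn_ge0.
apply: le_trans (_ : #|T|%:R * (B * projective_growth m kappa) ^+ l <= _); last first.
  by rewrite ler_wpM2r // lerDl.
apply: (@size_fibers_fin _ _ _ (fun w => c (P *m u w))) => // t.
set st := [seq w <- s | _].
have stP w : w \in st -> w \in s /\ c (P *m u w) = t.
  by rewrite mem_filter => /andP[/eqP ? ?].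
apply: (directional_chain B0 k0 eta0 dist step PJ P1) => //.
- by rewrite filter_uniq.
- move=> w /stP[ws _]; exact: H.
- move=> w w' /stP[/H[_ _ N] cw] /stP[/H[_ _ N'] cw'].
  by apply: cP; rewrite ?subr0 ?N ?N' // cw.
Qed.

End LevelStep.

Section Growth.
Context {R : realType} {d : nat} (f : paff R d)
  (cs : 'I_(npieces f) -> seq ('rV[R]_d * R))
  (csP : forall i x, piece f i x <-> sat (cs i) x)
  (fnd : paff_nondegenerate f).
Implicit Types (w v : seq 'I_(npieces f)) (x y : 'cV[R]_d).

Lemma exp_large (K delta : R) : 0 < delta ->
  exists n0, forall n, (n0 <= n)%N -> K <= expR (n%:R * delta).
Proof.
move=> delta0; exists (Num.trunc (`|K| / delta)).+1 => n n0.
apply: le_trans (ler_norm K) _; apply: le_trans (_ : n%:R * delta <= _).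
  rewrite -ler_pdivrMr //; apply: ltW.
  by apply: lt_le_trans (truncnS_gt _) _; rewrite ler_nat.
by apply: le_trans (expR_ge1Dx _); rewrite lerDr.
Qed.

Lemma projective_growth_ge0 m (kappa : R) : 0 <= kappa ->
  0 <= @projective_growth R d m kappa.
Proof.
move=> k0; rewrite mulr_ge0 // exprn_ge0 // addr_ge0 //.
by rewrite !mulr_ge0 // exprn_ge0.
Qed.

Lemma projective_growth_le m : exists2 K : R, 0 < K &
  forall kappa : R, 1 <= kappa -> @projective_growth R d m kappa <= K * kappa ^+ m.
Proof.
set E : R := (m.+1%:R * d%:R ^+ 2) ^+ 2.
have E0 : 0 <= E by rewrite exprn_ge0 // mulr_ge0 // exprn_ge0.
exists ((m.+1 * 2)%:R * (4 * E + 1) ^+ m) => [|kappa k1].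
  by rewrite mulr_gt0 ?ltr0n // exprn_gt0 // ltr_wpDl // mulr_ge0.
rewrite /projective_growth -/E -mulrA ler_wpM2l // -exprMn.
have k0 : 0 <= kappa by apply: le_trans k1.
rewrite lerXn2r ?nnegrE ?addr_ge0 ?mulr_ge0 ?addr_ge0 ?mulr_ge0 //.
by nra.
Qed.

(** Only arbitrarily large n are claimed, since the induction step produces multiples of a block
    length. The exponents add up by Pascal's rule 'C(m, 2) + m = 'C(m + 1, 2). *)
Lemma multiplicity_growth (Delta : R) m : 0 <= Delta ->
  (forall delta, 0 < delta -> exists n0, forall n, (n0 <= n)%N ->
     distortion_le f n (expR (n%:R * (Delta + delta)))) ->
  forall delta n0, 0 < delta -> exists2 n, (n0 <= n)%N &
    multiplicity_le cs m n (expR (n%:R * ('C(m, 2)%:R * Delta + delta))).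
Proof.
move=> Delta0 dist; elim: m => [|m IH] delta n0 delta0.
  exists n0 => // x P s Pf us H; apply: le_trans (multiplicity_le0 csP Pf us H) _.
  by rewrite -expR0 ler_expR mul0r add0r mulr_ge0 // ltW.
(* The error delta is split in four: the induction hypothesis, K, m times [d1], and C. *)
pose d1 := delta / (4 * m.+1%:R).
have d10 : 0 < d1 by rewrite divr_gt0 // mulr_gt0.
have d40 : 0 < delta / 4 by rewrite divr_gt0.
have [n1 n1P] := dist _ d10.
have [K K0 KP] := projective_growth_le m.
have [n2 n2P] := exp_large K d40.
have [n + multB] := IH (delta / 4) (maxn (maxn n1 n2) 1) d40.
rewrite !geq_max => /andP[/andP[nn1 nn2] n_gt0].
set B := expR _ in multB.
have [C C0 CP] := multiplicity_step csP fnd (expR_ge0 _) (expR_ge0 _) multB (n1P n nn1).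
set kappa := expR (n%:R * (Delta + d1)) in CP.
have k1 : 1 <= kappa.
  by rewrite -expR0 ler_expR mulr_ge0 // addr_ge0 // ltW.
have nd0 : 0 < n%:R * (delta / 4) by rewrite mulr_gt0 // ltr0n.
(* C depends on n through the mesh, so the number of blocks is chosen after it. *)
have [l0 l0P] := exp_large C nd0.
exists (n * maxn l0 n0)%N.
  by apply: leq_trans (leq_maxr l0 n0) _; rewrite leq_pmull.
set l := maxn l0 n0 => x P s Pf us H; apply: le_trans (CP l x P s Pf us H) _.
have lC := l0P l (leq_maxl _ _).
have BQ : B * projective_growth (d := d) m kappa <=
    expR (n%:R * (('C(m, 2) + m)%:R * Delta + 3 * (delta / 4))).
  apply: le_trans (_ : B * (expR (n%:R * (delta / 4)) * kappa ^+ m) <= _).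
    rewrite ler_wpM2l ?expR_ge0 //; apply: le_trans (KP _ k1) _.
    by rewrite ler_wpM2r ?n2P // exprn_ge0 // expR_ge0.
  rewrite /B /kappa -expRM_natl -!expRD ler_expR.
  have -> : n%:R * ('C(m, 2)%:R * Delta + delta / 4) +
    (n%:R * (delta / 4) + m%:R * (n%:R * (Delta + d1))) =
    n%:R * (('C(m, 2)%:R + m%:R) * Delta + (2 * (delta / 4) + m%:R * d1)) by ring.
  rewrite natrD ler_wpM2l // lerD2l.
  suff : m%:R * d1 <= delta / 4 by lra.
  rewrite /d1 mulrA ler_pdivrMr ?mulr_gt0 // mulrA divfK // mulrC.
  by rewrite ler_pM2l // ler_nat.
have BQ0 : 0 <= B * projective_growth (d := d) m kappa.
  by rewrite mulr_ge0 ?expR_ge0 // projective_growth_ge0 // expR_ge0.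
have BQl := lerXn2r l BQ0 (expR_ge0 _) BQ.
apply: le_trans (ler_pM (ltW C0) (exprn_ge0 l BQ0) lC BQl) _.
rewrite -expRM_natl -expRD ler_expR binS bin1 natrM le_eqVlt; apply/orP; left.
by apply/eqP; field.
Qed.

(** Compactness of the domain turns nearby points of different cylinders into one point adherent to
    all these cylinders. *)
Lemma near_points_multiplicity n (B : R) : multiplicity_le cs d n B -> 0 <= B ->
  exists2 eta : R, 0 < eta & forall (s : seq (seq 'I_(npieces f)))
    (y : seq 'I_(npieces f) -> 'cV[R]_d), uniq s ->
  (forall w, w \in s -> [/\ size w = n, paff_dom f (y w) & itin w (y w)]) ->
  (forall w w', w \in s -> w' \in s -> `|y w - y w'| <= eta) ->
  (size s)%:R <= B.
Proof.
move=> multB B0.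
pose L := flatten [seq wcs cs w | w <- map val (enum {: n.-tuple 'I_(npieces f)})].
have [e e0 eP] := compact_system L (@dom_compact _ _ f)
  (fun c : 'rV[R]_d * R => @continuous_linear_form R d c.1 c.2).
have [D D0 DP] := rV_norm_bound (map fst L).
(* Adding 1 keeps the divisor positive in dimension 0. *)
have dD : 0 < (d%:R + 1) * D by rewrite mulr_gt0 // ltr_wpDl.
exists (e / ((d%:R + 1) * D)) => [|s y us H close]; first by rewrite divr_gt0.
have inL w c : size w = n -> c \in wcs cs w -> c \in L.
  move=> sw cw; apply/flattenP; exists (wcs cs w) => //; apply: map_f.
  by apply/mapP; exists (Tuple (introT eqP sw)); rewrite ?mem_enum.
case: s us H close => [|w0 s0] // us; set s := w0 :: s0 in us * => H close.
have w0s : w0 \in s by rewrite mem_head.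
pose G (c : 'rV[R]_d * R) := exists2 w, w \in s & c \in wcs cs w.
have [_ X0 _] := H _ w0s.
have Hsat w : w \in s -> sat (wcs cs w) (y w).
  by move=> /H[_ _ ?]; exact/(sat_wcs csP).
have [|x _ xG] := eP G _ X0.
  move=> c cL [w ws cw].
  have cu := Hsat _ ws _ cw.
  have -> : (c.1 *m y w0) 0 0 = (c.1 *m y w) 0 0 + (c.1 *m (y w0 - y w)) 0 0.
    by rewrite mulmxBr mxBE addrC subrK.
  apply: le_trans (_ : `|c.1 *m (y w0 - y w)| <= _).
    have := mx_norm_entry (c.1 *m (y w0 - y w)) 0 0.
    have := ler_norm ((c.1 *m (y w0 - y w)) 0 0).
    by move: cu; lra.
  apply: le_trans (mx_norm_mul_le (DP _ (map_f fst cL)) (close _ _ w0s ws)) _.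
  rewrite mulrA ler_pdivrMr // mulrC ler_pM2l // ler_pM2r //.
  by rewrite lerDl.
(* The kernel of [1%:M] is zero, so every normal is admissible. A constraint active at x and strict
   at [y w] decreases along [y w - x]. *)
apply: (multB x 1%:M) => //; first by rewrite row_free_unit unitmx1.
move=> w ws; have [sw _ _] := H _ ws; split=> //; exists (y w - x) => a aw.
have : (a.1 *m x) 0 0 - a.2 <= 0 by apply: xG; [exact: inL sw aw|exists w].
rewrite subr_le0 le_eqVlt => /orP[/eqP ax|]; [right|by left].
by split=> //; [exact: submx1|rewrite mulmxBr mxBE ax subr_lt0; exact: Hsat aw].
Qed.

Definition separated N (theta : R) (s : seq 'cV[R]_d) := forall y y', y \in s ->
  y' \in s -> y != y' -> exists2 k, (k < N)%N & theta < `|iter k f y - iter k f y'|.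

Lemma iter_dom_le n N x : (n <= N)%N -> iter_dom f N x -> iter_dom f n x.
Proof. by move=> nN H k kn; apply: H; exact: leq_trans nN. Qed.

Lemma iter_wmap w k x : itin w x -> (k <= size w)%N ->
  iter k f x = wmap (take k w) x.
Proof.
rewrite -{1}(cat_take_drop k w) => /itin_cat[wx _] kw.
by rewrite -itin_wmap // size_takel.
Qed.

Lemma iter_close n v x y (Lam eta theta : R) k : itin v x -> itin v y ->
  (size v <= n)%N -> (k <= size v)%N ->
  (forall w, (size w <= n)%N -> `|wlin w| <= Lam) ->
  d%:R * Lam * eta <= theta -> `|x - y| <= eta ->
  `|iter k f x - iter k f y| <= theta.
Proof.
move=> vx vy vn kv lam le xy; rewrite !(iter_wmap (w := v)) // wmapB.
apply: le_trans le; apply: mx_norm_mul_le xy; apply: lam.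
by rewrite size_takel // (leq_trans kv).
Qed.

(** Points within eta have at most B first blocks. Those sharing one are mapped affinely into at
    most C M cells of diameter 2 d eta, each recut into at most (4 d + 1)^d cells of diameter eta,
    where the induction hypothesis applies to the images. *)
Lemma separated_chain n r (B Lam eta theta C M : R) : (0 < n)%N -> (r < n)%N ->
  0 <= B -> 0 < eta -> d%:R * Lam * eta <= theta -> 0 <= theta -> 0 <= C -> 0 <= M ->
  (forall w, (size w <= n)%N -> `|wlin w| <= Lam) ->
  (forall (A : 'M[R]_d) (M eta : R), minors_le A M -> 0 < eta ->
    exists2 T : finType, #|T|%:R <= C * M &
    exists c : 'cV[R]_d -> T, forall x y : 'cV[R]_d, `|x| <= eta -> `|y| <= eta ->
    c x = c y -> `|A *m x - A *m y| <= 2 * d%:R * eta) ->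
  (forall w x, size w = n -> itin w x -> minors_le (wlin w) M) ->
  (forall (s : seq (seq 'I_(npieces f)))
     (y : seq 'I_(npieces f) -> 'cV[R]_d), uniq s ->
    (forall w, w \in s -> [/\ size w = n, paff_dom f (y w) & itin w (y w)]) ->
    (forall w w', w \in s -> w' \in s -> `|y w - y w'| <= eta) ->
    (size s)%:R <= B) ->
  forall l s, uniq s -> (forall y, y \in s -> iter_dom f (n * l + r)%N y) ->
    (forall y y', y \in s -> y' \in s -> `|y - y'| <= eta) ->
    separated (n * l + r)%N theta s ->
    (size s)%:R <= (B * (C * M * (4 * d%:R + 1) ^+ d)) ^+ l *
      ((npieces f).+1 ^ n)%:R.
Proof.
move=> n0 rn B0 eta0 lae th0 C0 M0 lam lincode minors near; set K := C * M * _.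
have K0 : 0 <= K by rewrite mulr_ge0 ?exprn_ge0 ?mulr_ge0 // addr_ge0 // mulr_ge0.
have word N x : iter_dom f N x -> exists w, size w = N /\ itin w x.
  by move=> /iter_dom_itin[w ? ?]; exists w.
elim=> [|l IH] s us sdom close sep.
  rewrite muln0 add0n in sdom sep; rewrite expr0 mul1r -[leRHS]mulr1.
  have /choice[W WP] : forall y, exists w, y \in s -> size w = r /\ itin w y.
    move=> y; have [ys|ys] := boolP (y \in s); last by exists [::].
    by have [w] := word _ _ (sdom y ys); exists w.
  apply: (@size_fibers _ _ _ W) => // [|v].
    pose L := map val (enum {: r.-tuple 'I_(npieces f)}).
    have : (size (undup (map W s)) <= size L)%N.
      apply: uniq_leq_size; first exact: undup_uniq.
      move=> w; rewrite mem_undup => /mapP[y /WP[sw _] wE].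
      rewrite -wE in sw; apply/mapP; exists (Tuple (introT eqP sw)) => //.
      by rewrite mem_enum.
    rewrite size_map -cardE card_tuple card_ord ler_nat => /leq_trans; apply.
    (* The base is increased by 1 because powers of 0 are not monotone in the exponent. *)
    apply: leq_trans (_ : (npieces f).+1 ^ r <= _)%N.
      by case: (r) => // r'; rewrite leq_exp2r.
    by rewrite leq_pexp2l // ltnW.
  (* Points within eta that share a word of length r stay within theta, so separation leaves one per
     word. *)
  rewrite (ler_nat _ _ 1); apply: all_equal_size; first exact: filter_uniq.
  move=> y y'; rewrite !mem_filter => /andP[/eqP yv ys] /andP[/eqP yv' ys'].
  apply/eqP; apply: contraT => /(sep _ _ ys ys')[k kr].
  have [sy iy] := WP _ ys; have [sy' iy'] := WP _ ys'.
  rewrite yv in sy iy; rewrite yv' in iy'.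
  rewrite ltNge => /negP[]; apply: (iter_close iy iy' _ _ lam lae (close _ _ ys ys')) => //.
    by rewrite sy; exact: ltnW.
  by rewrite sy; exact: ltnW.
have BKl0 : 0 <= (B * K) ^+ l * ((npieces f).+1 ^ n)%:R.
  by rewrite mulr_ge0 // exprn_ge0 // mulr_ge0.
have /choice[W WP] : forall y, exists w, y \in s -> size w = n /\ itin w y.
  move=> y; have [ys|ys] := boolP (y \in s); last by exists [::].
  have [|w] := word n y; last by exists w.
  by apply: iter_dom_le (sdom y ys); rewrite mulnS -addnA leq_addr.
rewrite exprS -mulrA -(mulrA B); apply: (@size_fibers _ _ _ W) => [||v].
- by rewrite mulr_ge0.
- pose pre v := nth 0 s (index v (map W s)).
  have preP v : v \in undup (map W s) -> pre v \in s /\ W (pre v) = v.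
    rewrite mem_undup => vs; have := vs; rewrite -index_mem size_map => ilt.
    by split; [exact: mem_nth|rewrite -(nth_map 0 [::]) // nth_index].
  apply: (near _ pre) => //; first exact: undup_uniq.
    move=> w /preP[ps pw]; have [sw iw] := WP _ ps; rewrite pw in sw iw.
    split=> //; apply: piece_dom; apply: (sdom _ ps 0%N).
    by rewrite mulnS -addnA addn_gt0 n0.
  by move=> w w' /preP[ps _] /preP[ps' _]; exact: close.
set sv := [seq y <- s | W y == v].
have svP y : y \in sv -> [/\ y \in s, size v = n & itin v y].
  by rewrite mem_filter => /andP[/eqP <- ys]; have [] := WP _ ys; split.
have [->|[y0 y0s]] : sv = [::] \/ exists y, y \in sv.
  by case: {svP} sv => [|y sv']; [left|right; exists y; rewrite mem_head].
  by rewrite mulr_ge0.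
have [y0s' szv vy0] := svP _ y0s.
have [T1 T1c [c1 c1P]] := lincode _ _ _ (minors _ _ szv vy0) eta0.
rewrite {1}/K -(mulrA (C * M)).
apply: le_trans (ler_wpM2r _ T1c); last by rewrite mulr_ge0 // exprn_ge0 // addr_ge0 // mulr_ge0.
apply: (@size_fibers_fin _ _ _ (fun y => c1 (y - y0))) => [|t1].
  by rewrite mulr_ge0 // exprn_ge0 // addr_ge0 // mulr_ge0.
set s1 := [seq y <- sv | _].
have s1P y : y \in s1 -> y \in sv /\ c1 (y - y0) = t1.
  by rewrite mem_filter => /andP[/eqP ? ?].
have [->|[y1 y1s]] : s1 = [::] \/ exists y, y \in s1.
  by case: {s1P} s1 => [|y s1']; [left|right; exists y; rewrite mem_head].
  by rewrite mulr_ge0 // exprn_ge0 // addr_ge0 // mulr_ge0.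
have D0 : 0 <= 2 * d%:R * eta by rewrite !mulr_ge0 // ltW.
have [T2 T2c [c2 c2P]] := vector_code_at (wmap v y1) D0 eta0.
have T2c' : #|T2|%:R <= (4 * d%:R + 1) ^+ d :> R.
  apply: le_trans T2c _; rewrite !mulrA mulfK ?gt_eqF //.
  by rewrite -natrM.
apply: le_trans (ler_wpM2r BKl0 T2c').
apply: (@size_fibers_fin _ _ _ (fun y => c2 (wmap v y))) => // t2.
set s2 := [seq y <- s1 | _].
have s2P y : y \in s2 -> [/\ y \in s, itin v y, c2 (wmap v y) = t2 &
    `|wmap v y - wmap v y1| <= 2 * d%:R * eta].
  rewrite mem_filter => /andP[/eqP ct /s1P[ysv c1y]].
  have [ys _ vy] := svP _ ysv; split=> //.
  have [ysv1 c1y1] := s1P _ y1s; have [ys1 _ _] := svP _ ysv1.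
  rewrite wmapB (_ : y - y1 = y - y0 - (y1 - y0)); last by rewrite opprB addrA subrK.
  rewrite mulmxBr; apply: c1P.
  - exact: close.
  - exact: close.
  - by rewrite c1y.
have iterE y : y \in s2 -> iter n f y = wmap v y.
  by move=> /s2P[_ vy _ _]; rewrite -szv itin_wmap.
have sep2 y y' : y \in s2 -> y' \in s2 -> y != y' -> exists2 k, (k < n * l + r)%N &
    theta < `|iter k f (iter n f y) - iter k f (iter n f y')|.
  move=> /s2P[ys vy _ _] /s2P[ys' vy' _ _] /(sep _ _ ys ys')[k kN kth].
  (* A common first block and eta-closeness exclude separation up to time n; it occurs later and
     passes to the images. *)
  have [kn|nk] := leqP k n.
    move: kth; rewrite ltNge => /negP[].
    by apply: (iter_close vy vy' _ _ lam lae (close _ _ ys ys')) => //; rewrite szv.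
  exists (k - n)%N; first by rewrite ltn_subLR ?(ltnW nk) // addnA -mulnS.
  by rewrite -!iterD subnK // ltnW.
rewrite -(size_map (iter n f)); apply: IH.
- rewrite map_inj_in_uniq ?filter_uniq // => y y' ys ys' e.
  apply/eqP; apply: contraT => /(sep2 _ _ ys ys')[k _].
  by rewrite e subrr normr0 ltNge th0.
- move=> _ /mapP[y /s2P[ys _ _ _] ->] k kN; rewrite -iterD; apply: (sdom _ ys).
  by rewrite mulnS addnC -addnA ltn_add2l.
- move=> _ _ /mapP[y ys ->] /mapP[y' ys' ->]; rewrite !iterE //.
  have [_ _ c e] := s2P _ ys; have [_ _ c' e'] := s2P _ ys'.
  by apply: c2P; rewrite // c.
- move=> _ _ /mapP[y ys ->] /mapP[y' ys' ->] ne; apply: sep2 => //.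
  by apply: contraNneq ne => ->.
Qed.

End Growth.

(** * Separated sets and covers *)

Section Covers.
Context {R : realType} {d : nat} (f : paff R d)
  (cs : 'I_(npieces f) -> seq ('rV[R]_d * R))
  (csP : forall i x, piece f i x <-> sat (cs i) x)
  (fnd : paff_nondegenerate f).
Implicit Types (w v : seq 'I_(npieces f)) (x y : 'cV[R]_d).

Lemma wlin_norm_le : exists2 L : R, 1 <= L &
  forall w, `|wlin w| <= L ^+ size w /\ `|invmx (wlin w)| <= L ^+ size w.
Proof.
exists (1 + \sum_i (d%:R * `|linpart f i| + d%:R * `|invmx (linpart f i)|)).
  by rewrite lerDl sumr_ge0 // => i _; rewrite addr_ge0 // mulr_ge0.
set L := 1 + _.
have LP i : d%:R * `|linpart f i| <= L /\ d%:R * `|invmx (linpart f i)| <= L.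
  rewrite /L (bigD1 i) //=; set S := \sum_(_ | _) _.
  have : 0 <= S by rewrite sumr_ge0 // => j _; rewrite addr_ge0 // mulr_ge0.
  have : 0 <= d%:R * `|linpart f i| by rewrite mulr_ge0.
  have : 0 <= d%:R * `|invmx (linpart f i)| by rewrite mulr_ge0.
  by move=> *; split; lra.
have one : `|1%:M : 'M[R]_d| <= 1.
  by apply: mx_norm_le => // i j; rewrite mxE; case: eqP; rewrite ?normr1 ?normr0.
elim=> [|i w [IH1 IH2]] /=; first by rewrite invmx1 expr0.
have [L1 L2] := LP i; split.
  apply: le_trans (mx_norm_mul_le IH1 (lexx _)) _.
  by rewrite mulrAC exprS ler_pM // ?mulr_ge0 // (le_trans _ IH1).
rewrite invmx_mul ?wlin_unit //.
apply: le_trans (mx_norm_mul_le (lexx _) IH2) _.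
by rewrite exprS ler_pM // ?mulr_ge0 // (le_trans _ IH2).
Qed.

(** K depends on the dimension only and is fixed before n, so that n can absorb it; [C1] may depend
    on n and theta, being paid once. *)
Lemma separated_growth : exists2 K : R, 0 < K &
  forall n (B M theta : R), (0 < n)%N -> 0 <= B -> 0 <= M -> 0 < theta ->
  multiplicity_le cs d n B ->
  (forall w x, size w = n -> itin w x -> minors_le (wlin w) M) ->
  exists2 C1 : R, 0 < C1 & forall N s, (0 < N)%N -> uniq s ->
    (forall y, y \in s -> iter_dom f N y) -> separated f N theta s ->
    (size s)%:R <= C1 * (B * (K * M)) ^+ (N %/ n).
Proof.
have [C C1 lincode] := @linear_code R d d.
have C0 : 0 < C by apply: lt_le_trans C1.
exists (C * (4 * d%:R + 1) ^+ d).
  by rewrite mulr_gt0 // exprn_gt0 // ltr_wpDl // mulr_ge0.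
move=> n B M theta n0 B0 M0 th0 multB minors.
have [e e0 near] := near_points_multiplicity csP multB B0.
have [L L1 LP] := wlin_norm_le.
have Lam w : (size w <= n)%N -> `|wlin w| <= L ^+ n.
  move=> wn; have [h _] := LP w; apply: le_trans h _.
  by rewrite ler_weXn2l.
have Lam0 : 0 <= L ^+ n by rewrite exprn_ge0 // (le_trans _ L1).
have lam1 : 0 < d%:R * L ^+ n + 1 by rewrite ltr_wpDl // mulr_ge0.
(* The first bound limits the number of cylinders met; the second keeps eta-close points of one
   cylinder within theta for n iterations. *)
pose eta := Num.min e (theta / (d%:R * L ^+ n + 1)).
have eta0 : 0 < eta by rewrite lt_min e0 divr_gt0.
have laeta : d%:R * L ^+ n * eta <= theta.
  apply: le_trans (_ : (d%:R * L ^+ n + 1) * eta <= _).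
    by rewrite ler_wpM2r ?(ltW eta0) // lerDl.
  by rewrite mulrC -ler_pdivlMr // /eta ge_min lexx orbT.
have [D [D0 DX]] : exists D : R, 0 <= D /\ forall x, paff_dom f x -> `|x| <= D.
  have [M1 [_ M1P]] := compact_bounded (@dom_compact _ _ f).
  exists (`|M1| + 1); split; first by rewrite addr_ge0.
  by move=> x Xx; apply: M1P Xx => //; rewrite ltr_pwDr // ler_norm.
have [c cP] := vector_code d D0 eta0.
pose T : finType := ({ffun 'I_d -> 'I_(Num.trunc (2 * D / eta)).+1} : finType).
have P0 : 0 < ((npieces f).+1 ^ n)%:R :> R by rewrite ltr0n expn_gt0.
have Q0 l : 0 <= (B * (C * M * (4 * d%:R + 1) ^+ d)) ^+ l.
  by rewrite exprn_ge0 // !mulr_ge0 ?exprn_ge0 ?addr_ge0 ?mulr_ge0 // ltW.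
(* One factor counts the initial cells of the domain, the other the words of the last, incomplete
   block. *)
exists ((#|T|%:R + 1) * ((npieces f).+1 ^ n)%:R) => [|N s N0 us sdom sep].
  by rewrite mulr_gt0 // ltr_wpDl.
rewrite -mulrA (mulrC C) -(mulrA _ C) [_ ^+ d * _]mulrC.
apply: le_trans (_ : #|T|%:R * (((npieces f).+1 ^ n)%:R *
   (B * (C * M * (4 * d%:R + 1) ^+ d)) ^+ (N %/ n)) <= _); last first.
  by rewrite ler_wpM2r ?mulr_ge0 ?Q0 // lerDl.
apply: (@size_fibers_fin _ _ T c) => [|t]; first by rewrite mulr_ge0 ?Q0.
set st := [seq y <- s | _].
have stP y : y \in st -> y \in s /\ c y = t.
  by rewrite mem_filter => /andP[/eqP ? ?].
have NE : N = (n * (N %/ n) + N %% n)%N by rewrite mulnC -divn_eq.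
have bX y : y \in s -> `|y| <= D.
  by move=> /sdom /(_ 0%N N0) /piece_dom; exact: DX.
rewrite [leRHS]mulrC.
apply: (separated_chain n0 (ltn_pmod N n0) B0 eta0 laeta (ltW th0)
  (ltW C0) M0 Lam lincode minors) => //.
- move=> s' y us' H cl; apply: (near s' y) => // w w' ws ws'.
  by apply: le_trans (cl _ _ ws ws') _; rewrite /eta ge_min lexx.
- exact: filter_uniq.
- by move=> y /stP[ys _]; rewrite -NE; exact: sdom.
- move=> y y' /stP[ys cy] /stP[ys' cy']; apply: cP; rewrite ?bX //.
  by rewrite cy.
- by rewrite -NE => y y' /stP[ys _] /stP[ys' _]; exact: sep.
Qed.

(** A Lebesgue number argument: [rho] is tied to the norm only through neighbourhoods of each point,
    and compactness makes the comparison uniform. *)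
Lemma metrizes_uniform rho (e : R) : metrizes (paff_dom f) rho -> 0 < e ->
  exists2 theta : R, 0 < theta & forall x y, paff_dom f x -> paff_dom f y ->
    `|x - y| <= theta -> rho x y < e.
Proof.
case=> rho0 rhoE rhoC rhoT rhoN e0.
have /compact_near_coveringP cov := @dom_compact _ _ f.
have : \forall t \near (0 : R)^'+, paff_dom f `<=` [set x | forall y, paff_dom f x ->
    paff_dom f y -> `|x - y| <= t -> rho x y < e].
  apply: cov => x Xx.
  have : within (paff_dom f) (nbhs x) [set y | rho x y < e / 2].
    by apply/rhoN => //; exists (e / 2) => //; rewrite divr_gt0.
  rewrite /within /= => /nbhs_ballP[r /= r0 rP].
  have r2 : 0 < r / 2 by rewrite divr_gt0.
  have inr y : paff_dom f y -> `|x - y| < r -> rho x y < e / 2.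
    by move=> Xy xy; apply: rP => //; rewrite -ball_normE.
  exists (ball x (r / 2), [set t : R | t < r / 2]).
    split => /=; first exact: nbhsx_ballx.
    exact: nbhs_right_lt.
  case=> x' t /= [xx' tr] y Xx' Xy x'y.
  rewrite -ball_normE /= in xx'.
  apply: le_lt_trans (rhoT x' x y Xx' Xx Xy) _; rewrite (rhoC x') //.
  rewrite [e]splitr; apply: ltrD; apply: inr => //.
    by apply: lt_trans xx' _; rewrite ltr_pdivrMr // ltr_pMr // ltr1n.
  rewrite -(subrKA x') (le_lt_trans (ler_normD _ _)) // [r]splitr.
  by apply: ltrD => //; exact: le_lt_trans tr.
move=> near0.
have [t [t0 tP]] : exists t : R, 0 < t /\ (paff_dom f `<=` [set x | forall y,
    paff_dom f x -> paff_dom f y -> `|x - y| <= t -> rho x y < e]).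
  near ((0 : R)^'+) => t; exists t; split; last by near: t.
  by near: t; exact: nbhs_right_gt.
by exists t => // x y Xx Xy; exact: tP.
Unshelve. all: by end_near. Qed.

(** A separated set of maximal size, which exists since sizes are bounded, covers: a point outside
    all its balls could be added to it. *)
Lemma cover_num_le rho N (e theta Bd : R) : (0 < N)%N -> 0 < e -> 0 <= theta ->
  (forall x y, paff_dom f x -> paff_dom f y -> `|x - y| <= theta -> rho x y < e) ->
  (forall s, uniq s -> (forall y, y \in s -> iter_dom f N y) ->
    separated f N theta s -> (size s)%:R <= Bd) ->
  (cover_num rho f N e <= Bd%:E)%E.
Proof.
move=> N0 e0 th0 uni bound.
pose P k := `[< exists s, [/\ size s = k, uniq s,
  (forall y, y \in s -> iter_dom f N y) & separated f N theta s] >].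
have exP : exists k, P k by exists 0%N; apply/asboolP; exists [::].
have Pbd k : P k -> (k <= Num.trunc Bd)%N.
  move=> /asboolP[s [<- us sdom sep]].
  have sB := bound s us sdom sep.
  by rewrite -ltnS -(ltr_nat R); apply: le_lt_trans sB (truncnS_gt _).
case: (ex_maxnP exP Pbd) => k /asboolP[s [sk us sdom sep]] kmax.
apply: (@le_trans _ _ ((size s)%:R)%:E); last by rewrite lee_fin; exact: bound.
apply: ereal_inf_lbound; exists s => //; split=> // y yN.
have [x xs xy] : exists2 x, x \in s & forall k, (k < N)%N ->
    `|iter k f x - iter k f y| <= theta.
  have [ys|ys] := boolP (y \in s); first by exists y => // j _; rewrite subrr normr0.
  apply: contrapT => no.
  have far x : x \in s -> exists2 k, (k < N)%N & theta < `|iter k f x - iter k f y|.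
    move=> xs; apply: contrapT => no'; apply: no; exists x => // j jN.
    by rewrite leNgt; apply/negP => h; apply: no'; exists j.
  have : P k.+1.
    apply/asboolP; exists (y :: s); split; rewrite /= ?sk ?ys //.
      by move=> z; rewrite inE => /orP[/eqP -> //|]; exact: sdom.
    move=> a b; rewrite !inE => /orP[/eqP ->|ain] /orP[/eqP ->|bin].
    - by rewrite eqxx.
    - by have [j jN h] := far _ bin; exists j => //; rewrite distrC.
    - by move=> _; exact: far.
    - exact: sep.
  by move=> /kmax; rewrite ltnn.
exists x => //; apply: bigmax_lt => // j _.
have reg z : iter_dom f N z -> paff_dom f (iter j f z).
  by move=> /(_ j (ltn_ord j)) /piece_dom.
by apply: uni; [exact/reg/sdom|exact: reg|exact: xy].
Qed.

End Covers.

(** * Rates *)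

Section Rates.
Context {R : realType}.
Implicit Types (u v : nat -> \bar R).
Local Open Scope ereal_scope.

Lemma limn_esup_le u (h : \bar R) n0 : (forall n, (n0 <= n)%N -> u n <= h) ->
  limn_esup u <= h.
Proof.
move=> uh; apply: ge_ereal_inf.
exists (ereal_sup (u @` [set n | (n0 <= n)%N])).
  by exists [set n | (n0 <= n)%N] => //; exists n0.
by apply: ge_ereal_sup => _ [n /= n0n <-]; exact: uh.
Qed.

Lemma limn_esup_lt u (h : \bar R) : limn_esup u < h ->
  exists n0, forall n, (n0 <= n)%N -> u n <= h.
Proof.
move=> /ereal_inf_lt[_ [V [n0 _ n0V] <-]] Vh; exists n0 => n n0n.
by apply: le_trans (ltW Vh); apply: ereal_sup_ubound; exists n => //; exact: n0V.
Qed.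

Lemma limn_esup_mono u v : (forall n, u n <= v n) -> limn_esup u <= limn_esup v.
Proof.
move=> uv; apply: le_ereal_inf_tmp => _ [V FV <-].
apply: ge_ereal_inf; exists (ereal_sup (u @` V)); first by exists V.
apply: ge_ereal_sup => _ [n Vn <-]; apply: le_trans (uv n) _.
by apply: ereal_sup_ubound; exists n.
Qed.

Lemma lne_le (x : \bar R) (a : R) : x <= (expR a)%:E -> lne x <= a%:E.
Proof.
case: x => [r| |] //=; rewrite ?leNye //.
have [_ _|r0] := leP r 0%R; first by rewrite leNye.
by rewrite !lee_fin => ra; rewrite -ler_expR lnK.
Qed.

Lemma lne_mono (x y : \bar R) : x <= y -> lne x <= lne y.
Proof.
case: y => [s| |] xy; last 2 first.
- by rewrite [lne +oo]/= leey.
- by move: xy; rewrite leeNy_eq => /eqP ->.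
case: x xy => [r| |] //= rs; last by rewrite leNye.
have [_|r0] := leP r 0%R; first by rewrite leNye.
rewrite lee_fin in rs; have s0 : (0 < s)%R by apply: lt_le_trans rs.
by rewrite [(s <= 0)%R]leNgt s0 /= lee_fin ler_ln ?posrE.
Qed.

Lemma rate_ge (n : nat) (F a : R) : (0 < n)%N ->
  (n%:R^-1)%:E * lne F%:E <= a%:E -> (F <= expR (n%:R * a))%R.
Proof.
move=> n0 /=; have [F0 _|F0] := leP F 0%R.
  by apply: le_trans F0 _; exact: expR_ge0.
rewrite -EFinM lee_fin ler_pdivrMl ?ltr0n // => H.
by rewrite -(lnK F0) ler_expR.
Qed.

Lemma rate_le (n : nat) (x : \bar R) (a : R) : (0 < n)%N ->
  x <= (expR (n%:R * a))%:E -> (n%:R^-1)%:E * lne x <= a%:E.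
Proof.
move=> n0 /lne_le H.
have -> : a%:E = (n%:R^-1)%:E * (n%:R * a)%:E.
  by rewrite -EFinM mulKf // gt_eqF // ltr0n.
by rewrite lee_wpmul2l // lee_fin invr_ge0.
Qed.

Section SupRate.
Context {T : Type} (U : nat -> set T) (F : nat -> T -> R).

Definition sup_rate : \bar R :=
  limn_esup (fun n => ereal_sup [set (n%:R^-1)%:E * lne (F n x)%:E | x in U n]).

Lemma sup_rate_lt (a : R) : sup_rate < a%:E -> exists n0, forall n x,
  (n0 <= n)%N -> U n x -> (F n x <= expR (n%:R * a))%R.
Proof.
(* The successor excludes n = 0, where the factor 1 / n is 0. *)
move=> /limn_esup_lt[n0 H]; exists n0.+1 => n x n0n Unx.
have npos : (0 < n)%N by exact: leq_trans n0n.
apply: rate_ge => //; apply: le_trans (H n (ltnW n0n)).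
by apply: ereal_sup_ubound; exists x.
Qed.

Lemma sup_rate_le (a : R) : (forall n x, (0 < n)%N -> U n x ->
    (F n x <= expR (n%:R * a))%R) -> sup_rate <= a%:E.
Proof.
move=> H; apply: (@limn_esup_le _ _ 1) => n n0.
apply: ge_ereal_sup => _ [x Unx <-]; apply: rate_le => //.
by rewrite lee_fin; exact: H.
Qed.

End SupRate.

Lemma half_bin2 (d : nat) : (d%:R * (d%:R - 1) / 2 = 'C(d, 2)%:R :> R)%R.
Proof.
elim: d => [|d IH]; first by rewrite bin0n mul0r mul0r.
by rewrite binS bin1 natrD -IH -natr1; field.
Qed.

End Rates.

(** * Entropy and expansion rates of the map *)

Section Entropy.
Context {R : realType} {d : nat} (f : paff R d)
  (fnd : paff_nondegenerate f)
  (rho : 'cV[R]_d -> 'cV[R]_d -> R).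

Lemma paff_constraints : exists cs : 'I_(npieces f) -> seq ('rV[R]_d * R),
  forall i x, piece f i x <-> sat (cs i) x.
Proof.
suff /choice[cs csP] : forall i, exists l, forall x, piece f i x <-> sat l x.
  by exists cs.
move=> i; have [_ [m [H [Hh ->]]] _] := piece_polytope i.
have /choice[c cP] : forall j, exists c : 'rV[R]_d * R,
    H j = [set x | (c.1 *m x) 0 0 < c.2].
  by move=> j; have [a [b [_ ->]]] := Hh j; exists (a, b).
exists [seq c j | j <- enum 'I_m] => x; split=> [Hx _ /mapP[j _ ->]|Hx j _].
  by have := Hx j I; rewrite cP.
by rewrite cP; apply: Hx; apply: map_f; rewrite mem_enum.
Qed.

Lemma cover_num_anti n e1 e2 : e1 <= e2 ->
  (cover_num rho f n e2 <= cover_num rho f n e1)%E.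
Proof.
move=> e12; apply: ereal_inf_le_tmp => _ [s [sdom cov] <-].
exists s => //; split=> // y /cov[x xs xy]; exists x => //.
exact: lt_le_trans e12.
Qed.

(** Covering numbers decrease as the radius grows, so the limit defining [htop] exists in the
    extended reals and inherits the bound. *)
Lemma htop_le (h : \bar R) :
  (forall e : R, 0 < e -> (limn_esup (fun n =>
     (n%:R^-1)%:E * lne (cover_num rho f n e)) <= h)%E) -> (htop rho f <= h)%E.
Proof.
move=> H; apply: lime_le.
  apply: nonincreasing_at_right_is_cvge; near=> x => e1 e2 _ _ e12.
  apply: limn_esup_mono => n; rewrite lee_wpmul2l ?lee_fin ?invr_ge0 //.
  by apply: lne_mono; exact: cover_num_anti.
by near=> e; apply: H; near: e; exact: nbhs_right_gt.
Unshelve. all: by end_near. Qed.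

Lemma htop_empty n0 : iter_dom f n0 = set0 -> htop rho f = -oo%E.
Proof.
move=> U0; apply/eqP; rewrite -leeNy_eq; apply: htop_le => e e0.
apply: (@limn_esup_le _ _ _ n0.+1) => n n0n.
rewrite [lne _](_ : _ = -oo)%E.
  by rewrite gt0_muleNy // lte_fin invr_gt0 ltr0n (leq_ltn_trans _ n0n).
apply: le0_lneNy; apply: ereal_inf_lbound; exists [::] => //; split=> // y yn.
have : iter_dom f n0 y by apply: iter_dom_le yn; exact: ltnW.
by rewrite U0.
Qed.

Lemma itin_iter_dom (w : seq 'I_(npieces f)) x : itin w x -> iter_dom f (size w) x.
Proof. by move=> wx; apply/iter_dom_itin; exists w. Qed.

Lemma lambda_plus_minors (a : R) : (lambda_plus f < a%:E)%E ->
  exists n0, forall n k x, (n0 <= n)%N -> (k <= d)%N -> iter_dom f n x ->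
    opnorm (extpow k (diff_iter f n x)) <= expR (n%:R * a).
Proof.
move=> /limn_esup_lt[n0 H]; exists n0.+1 => n k x n0n kd nx.
have npos : (0 < n)%N by exact: leq_trans n0n.
apply: rate_ge => //; apply: le_trans (H n (ltnW n0n)).
apply: (@le_trans _ _ ((n%:R^-1)%:E *
   \big[maxe/-oo]_(k < d.+1) lne (opnorm (extpow k (diff_iter f n x)))%:E)%E).
  rewrite lee_wpmul2l ?lee_fin ?invr_ge0 //.
  rewrite -ltnS in kd.
  exact: (le_bigmax _ (fun k : 'I_d.+1 =>
    lne (opnorm (extpow k (diff_iter f n x)))%:E) (Ordinal kd)).
by apply: ereal_sup_ubound; exists x.
Qed.

Lemma expR_neg_small (a : R) : a < 0 -> forall C : R,
  exists n0, forall n, (n0 <= n)%N -> C * expR (n%:R * a) < 1.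
Proof.
move=> a0 C; have Na : 0 < - a by rewrite oppr_gt0.
have [n0 H] := exp_large (`|C| + 1) Na; exists n0 => n /H.
rewrite mulrN expRN; set E := expR _; have E0 : 0 < E by exact: expR_gt0.
rewrite -(ler_pM2r E0) mulVf ?gt_eqF // => h; apply: lt_le_trans h.
by rewrite ltr_pM2r //; have := ler_norm C; lra.
Qed.

(** The exterior power of degree 0 has norm at least 1 along every orbit. *)
Lemma lambda_plus_ge0 : (forall n, iter_dom f n !=set0) -> (0 <= lambda_plus f)%E.
Proof.
move=> U; rewrite leNgt; apply/negP => lt0.
have [a a0 la] : exists2 a : R, a < 0 & (lambda_plus f < a%:E)%E.
  move: lt0; case: (lambda_plus f) => [r| |] //; last by exists (-1) => //; rewrite ?ltrN10 // ltNyr.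
  by rewrite lte_fin => r0; exists (r / 2); [|rewrite lte_fin]; lra.
have [n0 H] := lambda_plus_minors la.
have [n1 H1] := expR_neg_small a0 1.
have [x Ux] := U (maxn n0 n1).
have := H _ 0%N x (leq_maxl _ _) (leq0n _) Ux.
have := H1 _ (leq_maxr n0 n1); have := opnorm_extpow0 (diff_iter f (maxn n0 n1) x).
by rewrite mul1r; lra.
Qed.

(** Replaces a difference of extended reals by a real number. In positive dimension the branch norms
    bound both rates above, and neither can be -oo because 1 <= d |A| |A^-1|. *)
Lemma distortion_rate : (forall n, iter_dom f n !=set0) ->
  exists Delta : R, [/\ 0 <= Delta,
    ((d%:R * (d%:R - 1) / 2)%:E * (lambda_max f - lambda_min f) =
      ('C(d, 2)%:R * Delta)%:E)%E &
    forall delta, 0 < delta -> exists n0, forall n, (n0 <= n)%N ->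
      distortion_le f n (expR (n%:R * (Delta + delta)))].
Proof.
move=> U; have [d0|d_gt0] := posnP d.
  (* In dimension 0 the rates are infinite, and the coefficient 0 annihilates them. *)
  exists 0; split=> //.
    by rewrite half_bin2 (_ : 'C(d, 2) = 0%N) ?mul0e ?mul0r // d0.
  move=> delta _; exists 0%N => n _ w x _ _.
  suff -> : `|wlin w| = 0 by rewrite mul0r expR_ge0.
  apply/eqP; rewrite normr_eq0; apply/eqP/matrixP => i.
  by have := ltn_ord i; rewrite {2}d0.
pose Fm n x := opnorm (diff_iter f n x).
pose Fi n x := opnorm (invmx (diff_iter f n x)).
have lmE : lambda_max f = sup_rate (iter_dom f) Fm by [].
have liE : lambda_min f = (- sup_rate (iter_dom f) Fi)%E by [].
rewrite lmE liE oppeK.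
have [L L1 LP] := wlin_norm_le fnd.
have D1 : 1 <= d%:R * d%:R :> R by rewrite -natrM ler1n muln_gt0 d_gt0.
have L0 : 0 < L by apply: lt_le_trans L1.
have bound (A : 'M[R]_d) n : (0 < n)%N -> `|A| <= L ^+ n ->
    opnorm A <= expR (n%:R * ln (d%:R * d%:R * L)).
  move=> n0 AL; rewrite expRM_natl lnK; last by rewrite posrE mulr_gt0 // (lt_le_trans _ D1).
  apply: le_trans (opnorm_le A) _; rewrite exprMn mulrA.
  apply: ler_pM => //.
  apply: le_trans (_ : d%:R * d%:R <= _).
    rewrite ler_wpM2r // -[leRHS]ger0_norm // -sqrtr_sqr ler_wsqrtr //.
    by rewrite -natrX ler_nat leq_pmulr.
  by rewrite -[leLHS]expr1 ler_weXn2l.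
have wordE n x : iter_dom f n x -> exists w : seq 'I_(npieces f), [/\ size w = n,
    diff_iter f n x = wlin w & itin w x].
  by move=> /iter_dom_itin[w sw wx]; exists w; split=> //; rewrite -sw itin_diff.
have Fmfin : (sup_rate (iter_dom f) Fm <= (ln (d%:R * d%:R * L))%:E)%E.
  apply: sup_rate_le => n x n0 /wordE[w [sw wE _]]; apply: bound => //.
  by rewrite wE -sw; case: (LP w).
have Fifin : (sup_rate (iter_dom f) Fi <= (ln (d%:R * d%:R * L))%:E)%E.
  apply: sup_rate_le => n x n0 /wordE[w [sw wE _]]; apply: bound => //.
  by rewrite wE -sw; case: (LP w).
(* If a + b were negative, d exp(n (a + b)) would fall below 1 for large n, against 1 <= d |A|
   |A^-1|. *)
have pos (a b : R) : (sup_rate (iter_dom f) Fm < a%:E)%E ->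
    (sup_rate (iter_dom f) Fi < b%:E)%E -> 0 <= a + b.
  move=> /sup_rate_lt[n1 H1] /sup_rate_lt[n2 H2]; rewrite leNgt; apply/negP => ab.
  have [n3 H3] := expR_neg_small ab d%:R.
  pose n := maxn (maxn n1 n2) n3.
  have [x Ux] := U n.
  have := H1 n x _ Ux; have := H2 n x _ Ux; have := H3 n (leq_maxr _ _).
  rewrite /n !leq_max !leqnn !orbT /= -/n => h3 /(_ isT) h2 /(_ isT) h1.
  have [w [sw wE _]] := wordE n x Ux.
  rewrite /Fm /Fi wE in h1 h2.
  have : 1 <= d%:R * `|wlin w| * `|invmx (wlin w)|.
    apply: le_trans (mx_norm_mul _ _); rewrite mulmxV ?wlin_unit //.
    have := mx_norm_entry (1%:M : 'M[R]_d) (Ordinal d_gt0) (Ordinal d_gt0).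
    by rewrite mxE eqxx normr1.
  rewrite leNgt => /negP; apply; apply: le_lt_trans h3.
  rewrite mulrDr expRD mulrA.
  apply: ler_pM => //.
    by rewrite ler_wpM2l // (le_trans (mx_norm_opnorm _)).
  exact: le_trans (mx_norm_opnorm _) h2.
move: pos (@sup_rate_lt _ _ (iter_dom f) Fm) (@sup_rate_lt _ _ (iter_dom f) Fi).
move: Fmfin Fifin.
set s1 := sup_rate _ Fm; set s2 := sup_rate _ Fi.
case: s1 => [r1| |] //=; case: s2 => [r2| |] //=; last 3 first.
(* A rate equal to -oo lies below every real; in each case the tested values have sum -1. *)
- move=> _ _ pos; have := pos (r1 + 1) (- r1 - 2).
  by rewrite lte_fin ltrDl ltr01 ltNyr => /(_ isT isT); lra.
- move=> _ _ pos; have := pos (- r2 - 2) (r2 + 1).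
  by rewrite lte_fin ltrDl ltr01 ltNyr => /(_ isT isT); lra.
- by move=> _ _ pos; have := pos (-1) 0; rewrite !ltNyr => /(_ isT isT); lra.
move=> _ _ pos H1 H2; exists (r1 + r2); split.
- apply/ler_addgt0Pr => e e0; have e2 : 0 < e / 2 by rewrite divr_gt0.
  have := pos (r1 + e / 2) (r2 + e / 2).
  by rewrite !lte_fin !ltrDl e2 => /(_ isT isT); lra.
- by rewrite half_bin2 -EFinD -EFinM.
move=> delta delta0; have d2 : 0 < delta / 2 by rewrite divr_gt0.
have [|n1 H1'] := H1 (r1 + delta / 2); first by rewrite lte_fin ltrDl.
have [|n2 H2'] := H2 (r2 + delta / 2); first by rewrite lte_fin ltrDl.
exists (maxn n1 n2) => n; rewrite geq_max => /andP[nn1 nn2] w x sw wx.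
have Ux : iter_dom f n x by rewrite -sw; exact: itin_iter_dom.
have -> : n%:R * (r1 + r2 + delta) = n%:R * (r1 + delta / 2) + n%:R * (r2 + delta / 2).
  by field.
rewrite expRD; have wE := itin_diff wx; rewrite sw in wE.
apply: ler_pM => //.
  by apply: le_trans (mx_norm_opnorm _) _; rewrite -wE; exact: H1'.
by apply: le_trans (mx_norm_opnorm _) _; rewrite -wE; exact: H2'.
Qed.

End Entropy.

(** Three quarters of delta are spent within a block, on the multiplicity, on K and on the minors;
    the last one absorbs [C1]. *)
Lemma entropy_rate (R : realType) (d : nat) (f : paff R d)
    (rho : 'cV[R]_d -> 'cV[R]_d -> R) (Lp Delta e delta : R) :
  paff_nondegenerate f -> metrizes (paff_dom f) rho ->
  0 <= Lp -> 0 <= Delta -> (lambda_plus f <= Lp%:E)%E ->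
  (forall delta, 0 < delta -> exists n0, forall n, (n0 <= n)%N ->
    distortion_le f n (expR (n%:R * (Delta + delta)))) ->
  0 < e -> 0 < delta ->
  (limn_esup (fun n => (n%:R^-1)%:E * lne (cover_num rho f n e)) <=
    (Lp + 'C(d, 2)%:R * Delta + delta)%:E)%E.
Proof.
move=> fnd met Lp0 Delta0 lp dist e0 delta0.
have [cs csP] := paff_constraints f.
have d40 : 0 < delta / 4 by rewrite divr_gt0.
have [n1 n1P] : exists n0, forall n k x, (n0 <= n)%N -> (k <= d)%N ->
    iter_dom f n x ->
    opnorm (extpow k (diff_iter f n x)) <= expR (n%:R * (Lp + delta / 4)).
  by apply: lambda_plus_minors; apply: le_lt_trans lp _; rewrite lte_fin ltrDl.
have [K K0 growth] := separated_growth csP fnd.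
have [n2 n2P] := exp_large K d40.
have [n + multB] := multiplicity_growth csP fnd d Delta0 dist
  (maxn (maxn n1 n2) 1) d40.
rewrite !geq_max => /andP[/andP[nn1 nn2] n_gt0].
have minors (w : seq 'I_(npieces f)) x : size w = n -> itin w x ->
    minors_le (wlin w) (expR (n%:R * (Lp + delta / 4))).
  move=> sw wx; apply: minors_le_incr => [|k kd]; first exact: expR_ge0.
  have := itin_diff wx; rewrite sw => <-; apply: n1P => //.
  by rewrite -sw; exact: itin_iter_dom.
have [theta th0 uni] := metrizes_uniform met e0.
have [C1 C10 count] := growth n _ _ theta n_gt0 (expR_ge0 _) (expR_ge0 _) th0
  multB minors.
have [n3 n3P] := exp_large C1 d40.
set h := Lp + 'C(d, 2)%:R * Delta.
have h0 : 0 <= h by rewrite addr_ge0 // mulr_ge0.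
apply: (@limn_esup_le _ _ _ (maxn n3 1)) => N; rewrite geq_max => /andP[N3 N0].
apply: rate_le => //; apply: (cover_num_le N0 e0 (ltW th0) uni) => s us sdom sep.
apply: le_trans (count N s N0 us sdom sep) _.
set Q := _ * (K * _).
have QE : Q <= expR (n%:R * (h + 3 * (delta / 4))).
  have -> : n%:R * (h + 3 * (delta / 4)) = n%:R * ('C(d, 2)%:R * Delta + delta / 4) +
      (n%:R * (delta / 4) + n%:R * (Lp + delta / 4)) by rewrite /h; ring.
  rewrite !expRD ler_wpM2l ?expR_ge0 // ler_wpM2r ?expR_ge0 //.
  exact: n2P.
have Q0 : 0 <= Q by rewrite !mulr_ge0 ?expR_ge0 // ltW.
have QN : Q ^+ (N %/ n) <= expR (N%:R * (h + 3 * (delta / 4))).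
  apply: le_trans (lerXn2r (N %/ n) Q0 (expR_ge0 _) QE) _.
  (* Replacing n (N %/ n) by N requires a nonnegative rate; this is where 0 <= Lp enters. *)
  rewrite -expRM_natl ler_expR mulrA ler_wpM2r //.
    by rewrite addr_ge0 // mulr_ge0 // ltW.
  by rewrite -natrM ler_nat leq_divM.
apply: le_trans (ler_pM (ltW C10) (exprn_ge0 _ Q0) (n3P N N3) QN) _.
by rewrite -expRD ler_expR le_eqVlt; apply/orP; left; apply/eqP; field.
Qed.

Theorem mainTheorem6 (R : realType) (d : nat) (f : paff R d)
    (f_nondegenerate : paff_nondegenerate f)
    (rho : 'cV[R]_d -> 'cV[R]_d -> R) (rho_metric : metrizes (paff_dom f) rho) :
  (htop rho f <=
     lambda_plus f
     + (d%:R * (d%:R - 1) / 2)%:E * (lambda_max f - lambda_min f))%E.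
Proof.
(* If some iterate is defined nowhere, the entropy is -oo. Otherwise all the suprema run over
   nonempty sets. *)
have [U|/existsNP[n0 /set0P/negP/negPn/eqP U0]] :=
  pselect (forall n, iter_dom f n !=set0); last by rewrite (htop_empty rho U0) leNye.
have [Delta [Delta0 -> dist]] := distortion_rate f_nondegenerate U.
have := lambda_plus_ge0 U; case lpE: (lambda_plus f) => [Lp| |] // Lp0.
  rewrite lee_fin in Lp0; apply: htop_le => e e0; apply/lee_addgt0Pr => delta delta0.
  rewrite -!EFinD; apply: entropy_rate => //; by rewrite lpE.
by rewrite addye // leey.
Qed.
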